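(* Let $n\ge1$ and $G=SU(n+1,1)$. For $0\le p,q\le n$ with $0\le p+q\le n$ let $\alpha\in\Gamma(\mathcal H_{p,q})$ with $\alpha(u)=0$ for a point $u\in S^{2n+1}=\partial B$. Let $\gamma\colon[0,a)\to\overline B$ be a continuous curve with $\gamma(0)=u$ and $\gamma(t)\in B$ for $t>0$. Then $$\lim_{t\to0}\underline\Phi_{p,q}(\alpha)(\gamma(t))=0.$$
   Context: **Groups and spaces.** $G=SU(n+1,1)$ is the group of determinant-one matrices preserving a Hermitian form of signature $(n+1,1)$ on $\mathbb C^{n+2}$, with Lie algebra $\mathfrak g$, Cartan involution $\theta$, Cartan decomposition $\mathfrak g=\mathfrak k\oplus\mathfrak q$, maximal compact subgroup $K$, $P$ the stabilizer of a null line, with Lie algebra $\mathfrak p=\mathfrak g_0\oplus\mathfrak g_1\oplus\mathfrak g_2$ for the $|2|$-grading $\mathfrak g=\bigoplus_{i=-2}^2\mathfrak g_i$, $\theta(\mathfrak g_i)=\mathfrak g_{-i}$, and $M=K\cap P$. $G/K$ (negative lines) is identified with the open unit ball $B\subset\mathbb C^{n+1}$ with the Bergman metric $h(z)(\xi,\eta)=\frac{\langle\xi,\eta\rangle}{1-|z|^2}+\frac{\langle\xi,z\rangle\langle z,\eta\rangle}{(1-|z|^2)^2}$ (via $v\mapsto$ line through $v+v_-$, $v\in\ell_-^\perp\cong\mathbb C^{n+1}$, with $v_-$ a vector of length $-1$ spanning the negative line $\ell_-$ stabilized by $K$), and by the same map $G/P\cong K/M\cong S^{2n+1}=\partial B$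 with its standard CR structure. $\overline B$ is the closed unit ball. **Bundles.** $H\subset T(G/P)$ is the CR subbundle with complex structure $J$, $\Lambda^kH^*\otimes\mathbb C=\bigoplus_{p+q=k}\Lambda^{p,q}H^*$; $\omega_H$ is the restriction to $H$ of $d\vartheta$ for a $K$-invariant contact form $\vartheta$ with kernel $H$, and $L_H^*$ is the adjoint of wedging with $\omega_H$. For $p+q\le n$, $\mathcal H_{p,q}=\ker(L_H^*|_{\Lambda^{p,q}H^*})$. **Poisson transforms.** $G/M\cong G/K\times G/P$ with projections $\pi_K,\pi_P$, $T(G/M)=T_K\oplus T_P$, $T_K=\ker T\pi_P$, $T_P=\ker T\pi_K$; $T_K^*$, $T_P^*$ are induced by the $M$-modules $(\mathfrak g/\mathfrak k)^*$, $(\mathfrak g/\mathfrak p)^*$. The $M$-equivariant map $\iota_k\colon\Lambda^k(\mathfrak g/\mathfrak p)^*\to\Lambda^k(\mathfrak g/\mathfrak k)^*$, $\iota_k(\alpha)(Y_1,\dots,Y_k)=\alpha(\theta Y_1-Y_1,\dots,\theta Y_k-Y_k)$, induces a bundle map $\Lambda^kT_P^*\to\Lambda^kT_K^*$. $\operatorname{vol}_M$ is the $G$-invariant section of $\Lambda^{2n+1}T_P^*$ for which $\pi_K^{-1}(eK)$ has volume one. Let $p+q=k\le n$. For $\sigma\in\Gamma(\mathcal H_{p,q})$ let $\underline\sigma\in\Gamma(\Lambda^kT_P^*\otimes\mathbb C)$ be its pullback to $G/M$, extended by zero on the line bundle complementary to the pullback of $H$ in $T_P$ coming from the $M$-invariant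 decomposition $\mathfrak g/\mathfrak p\cong\mathfrak g_{-1}\oplus\mathfrak g_{-2}$. Then $\underline\Phi_{p,q}(\sigma)=\int_{G/P}\iota_k(\underline\sigma)\otimes\operatorname{vol}_M\in\Omega^{p,q}(G/K)$ (integration over the fibres of $\pi_K$), viewed as a differential form on $B$.
   Formalization: The limit is proved in Bergman norm and in Euclidean norm on vectors complex-orthogonal to γ(t), not for all coordinate coefficients: for n=1, α=conj(z_0)dz_0|_H, u=(0,1), γ(t)=(0,1−t), the dz_1 coefficient tends to 1. *)

(* Defs.v *)
(* MathComp-Analysis. *)
From HB Require Import structures.
From mathcomp Require Import all_boot all_order all_algebra all_fingroup complex.
From mathcomp Require Import all_classical all_reals all_analysis.

Set Implicit Arguments.
Unset Strict Implicit.
Unset Printing Implicit Defensive.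

Import Order.TTheory GRing.Theory Num.Theory.
Import numFieldNormedType.Exports.

Local Open Scope classical_set_scope.
Local Open Scope sesquilinear_scope.
Local Open Scope complex_scope.
Local Open Scope ring_scope.

(* The complex numbers over [R], typed so that the topology of a numFieldType
   is found on them and on matrices over them. *)
Definition Cplx (R : realType) : numClosedFieldType := R[i].

Definition toC (R : realType) (x : R) : Cplx R := x%:C.

(* Linear in the first argument. *)
Definition herm (R : realType) m (x y : 'cV[Cplx R]_m) : Cplx R :=
  (y^t* *m x) 0 0.

Definition Bball (R : realType) m : set 'cV[Cplx R]_m := [set z | herm z z < 1].

Definition Bsphere (R : realType) m : set 'cV[Cplx R]_m :=
  [set z | herm z z = 1].

(* A form on B is small near the boundary if it is small on vectors of length
   at most 1 for this metric and, more precisely in the CR directions, on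
   Euclidean unit vectors complex orthogonal to the base point.  Its
   coefficients in the coordinates of C^{n+1} are not the right measure of
   size: for n = 1 the section (conj z_0) dz_0 of H_{1,0} vanishes at (0, 1),
   while the coefficient of dz_1 in its Poisson transform at (0, r) tends to 1
   as r tends to 1. *)
Definition bergman (R : realType) m (z x y : 'cV[Cplx R]_m) : Cplx R :=
  herm x y / (1 - herm z z) + herm x z * herm z y / (1 - herm z z) ^+ 2.

Section Group.
Variables (R : realType) (n : nat).
Local Notation C := (Cplx R).
Local Notation vec := 'cV[C]_n.+1.
Local Notation mat := 'M[C]_(n.+1 + 1).

(* C^{n+2} is split as C^{n+1} + C; the last coordinate spans the negative
   line fixed by K. *)
Definition Jform : mat := block_mx 1%:M 0 0 (- 1%:M).

Definition SU (g : mat) : Prop := g^t* *m Jform *m g = Jform /\ \det g = 1.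

Definition cartan (X : mat) : mat := - (X^t*).

Definition homog (z : vec) : 'cV[C]_(n.+1 + 1) := col_mx z 1%:M.

(* The point of C^{n+1} representing the line through [v], and the
   differential of this map at [v] in the direction [w] (quotient rule). *)
Definition affine (v : 'cV[C]_(n.+1 + 1)) : vec :=
  (dsubmx v 0 0)^-1 *: usubmx v.

Definition daffine (v w : 'cV[C]_(n.+1 + 1)) : vec :=
  (dsubmx v 0 0)^-1 *: usubmx w
  - (dsubmx w 0 0 / dsubmx v 0 0 ^+ 2) *: usubmx v.

(* The action of G on the closed ball, and the differential of [act g]. *)
Definition act (g : mat) (z : vec) : vec := affine (g *m homog z).

Definition dact (g : mat) (z x : vec) : vec :=
  daffine (g *m homog z) (g *m col_mx x 0).

(* P is the stabilizer of the null line through [homog basept]. *)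
Definition basept : vec := delta_mx 0 0.

(* Grading element, with eigenvalues 1, -1, 0 on C^{n+2}, and its spectral
   projections.  A matrix of the form Pa X Pb, with Pa, Pb the projections
   to the a- and b-eigenspaces, is an (a - b)-eigenvector of ad gradE. *)
Definition gradE : mat := block_mx 0 basept (basept^t*) 0.
Definition projp : mat := 2%:R^-1 *: (gradE *m gradE + gradE).
Definition projm : mat := 2%:R^-1 *: (gradE *m gradE - gradE).
Definition proj0 : mat := 1%:M - gradE *m gradE.

(* The component of [X] in g_{-1}. *)
Definition grm1 (X : mat) : mat :=
  proj0 *m X *m projp + projm *m X *m proj0.

(* The element of q whose value at the origin of the ball is [y]; the map
   identifies T_0 B with q, hence with g/k. *)
Definition qelt (y : vec) : mat := block_mx 0 y (y^t*) 0.

(* The columns of a matrix [Xi] with [k] columns are [k] tangent vectors; a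
   k-form field is a function of a point and of such a matrix. *)
Definition forms k := vec -> 'M[C]_(n.+1, k) -> C.

(* The M-equivariant function G -> Lambda^k (g/p)^* of the pullback of
   [al] to G/M, extended by zero on the line of g_{-2}: a tangent vector
   [g, X + p] of G/P is d/dt g exp(tX).basept, and only the g_{-1}-component
   of X is kept. *)
Definition pullback k (al : forms k) (g : mat) (X : 'I_k -> mat) : C :=
  al (act g basept)
     (\matrix_(i, j) daffine (g *m homog basept)
                             (g *m grm1 (X j) *m homog basept) i 0).

Definition iota_form k (phi : ('I_k -> mat) -> C) (Y : 'I_k -> mat) : C :=
  phi (fun j => cartan (Y j) - Y j).

(* A point of G/M over (z, u) in G/K x G/P.  It exists for [z] in the ball and
   [u] in the sphere, and is unique modulo M. *)
Definition lift (z u : vec) : mat :=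
  xget 1%:M [set g | [/\ SU g, act g 0 = z & act g basept = u]].

(* The form iota_k (pullback of al) at the point (z, u) of G/M, evaluated on
   tangent vectors of B at [z] (T_K is the pullback of T(G/K)). *)
Definition kernel_form k (al : forms k) (z u : vec) (Xi : 'M[C]_(n.+1, k)) : C :=
  let g := lift z u in
  iota_form (pullback al g)
            (fun j => qelt (dact (invmx g) z (col j Xi))).

(* C^{n+1} with its Borel sigma-algebra. *)
Definition borel_vec := g_sigma_algebraType (@open vec).

(* vol_M restricted to the fibre {z} x S of pi_K over [z] is a measure
   [vol z] carried by the sphere; vol_M is the G-invariant family of total
   mass one. *)
Definition is_volM (vol : vec -> probability borel_vec R) : Prop :=
  (forall z, Bball z -> vol z (@Bsphere R n.+1) = 1%E) /\
  (forall g z (A : set borel_vec), SU g -> Bball z -> measurable A ->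
     vol (act g z) A = vol z (@Bsphere R n.+1 `&` act g @^-1` A)).

Definition Cintegral (mu : probability borel_vec R) (D : set borel_vec)
    (f : vec -> C) : C :=
  (Rintegral mu D (fun u => complex.Re (f u)))
    +i* (Rintegral mu D (fun u => complex.Im (f u))).

Definition Poisson (vol : vec -> probability borel_vec R) k (al : forms k) :
    forms k :=
  fun z Xi => Cintegral (vol z) (@Bsphere R n.+1)
                (fun u => kernel_form al z u Xi).

End Group.

Section CRforms.
Variables (R : realType) (n : nat).
Local Notation C := (Cplx R).
Local Notation vec := 'cV[C]_n.+1.

(* The columns of [Xi] are in H_u, the complex subspace T_u S /\ i T_u S. *)
Definition inH (u : vec) k (Xi : 'M[C]_(n.+1, k)) : Prop := u^t* *m Xi = 0.

(* Lambda^{p,q} H_u^* is spanned by the products of [p] complex linear (rows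
   of [a]) and [q] conjugate linear (rows of [b]) functionals. *)
Definition type_pq (p q : nat) (u : vec) (phi : 'M[C]_(n.+1, p + q) -> C) :
    Prop :=
  exists m (c : 'I_m -> C) (a : 'I_m -> 'M[C]_(p, n.+1))
           (b : 'I_m -> 'M[C]_(q, n.+1)),
    forall Xi, inH u Xi ->
      phi Xi = \sum_(j < m)
        c j * \det (col_mx (a j *m Xi) (b j *m map_mx Num.conj Xi)).

(* A K-invariant contact form with kernel H.  It is linear in the point, so
   d(contact)(x, y) = contact x y - contact y x. *)
Definition contact (z x : vec) : R := complex.Im (herm x z).

Definition omegaH (x y : vec) : C := toC (contact x y - contact y x).

Definition setcol k (Xi : 'M[C]_(n.+1, k)) (i : 'I_k) (x : vec) :
    'M[C]_(n.+1, k) :=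
  \matrix_(r, j) (if j == i then x r 0 else Xi r j).

(* Elements of Lambda^m H_u^* (x) C. *)
Definition is_form m (u : vec) (be : 'M[C]_(n.+1, m) -> C) : Prop :=
  (forall Xi i x y (c : R), inH u Xi -> inH u x -> inH u y ->
     be (setcol Xi i (toC c *: x + y)) =
     toC c * be (setcol Xi i x) + be (setcol Xi i y)) /\
  (forall Xi i j, inH u Xi -> i != j -> col i Xi = col j Xi -> be Xi = 0).

Definition L_H m (be : 'M[C]_(n.+1, m) -> C) (Xi : 'M[C]_(n.+1, 2 + m)) : C :=
  ((2`! * m`!)%N%:R)^-1 * \sum_(s : 'S_(2 + m)) (-1) ^+ s
    * (omegaH (col 0 (lsubmx (col_perm s Xi))) (col 1 (lsubmx (col_perm s Xi)))
       * be (rsubmx (col_perm s Xi))).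

(* [e] is a unitary basis of H_u, so that [row_mx e ('i *: e)] is a real
   orthonormal one. *)
Definition is_frame (u : vec) (e : 'M[C]_(n.+1, n)) : Prop :=
  inH u e /\ e^t* *m e = 1%:M.

Definition form_dot k (e : 'M[C]_(n.+1, n)) (al be : 'M[C]_(n.+1, k) -> C) : C :=
  let E := row_mx e ('i *: e) in
  (k`!%:R)^-1 * \sum_(I : {ffun 'I_k -> 'I_(n + n)})
    al (colsub I E) * (be (colsub I E))^*.

(* L_H^* phi = 0: the adjoint L_H^* is determined by
   <L_H^* phi, be> = <phi, L_H be> for all [be]. *)
Definition L_H_adj_zero k (u : vec) (phi : 'M[C]_(n.+1, k) -> C) : Prop :=
  forall m (km : (2 + m = k)%N) (be : 'M[C]_(n.+1, m) -> C) e,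
    is_form u be -> is_frame u e ->
    form_dot e (fun Xi => phi (castmx (erefl, km) Xi)) (L_H be) = 0.

(* All iterated directional derivatives are differentiable on [U]. *)
Definition smooth_on (V : normedModType R) (U : set V) (f : V -> R) : Prop :=
  forall (s : seq V) x, U x ->
    differentiable (foldr (fun v g => fun y => 'D_v g y) f s) x.

Definition ofReal (w : 'cV[R]_(n.+1 + n.+1)) : vec :=
  \col_i (w (lshift n.+1 i) 0 +i* w (rshift n.+1 i) 0).

Definition projH (z : vec) k (Xi : 'M[C]_(n.+1, k)) : 'M[C]_(n.+1, k) :=
  Xi - (herm z z)^-1 *: (z *m (z^t* *m Xi)).

(* A section of Lambda^k H^* is smooth iff its values on the sections
   [projH _ Xi], which span H at each point, are smooth functions on the sphere,
   i.e. have smooth 0-homogeneous extensions to C^{n+1} minus the origin. *)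
Definition smooth_form k (al : forms R n k) : Prop :=
  forall Xi : 'M[C]_(n.+1, k),
    let f w := let z := ofReal w in
               al ((sqrtC (herm z z))^-1 *: z) (projH z Xi) in
    smooth_on [set w | w != 0] (fun w => complex.Re (f w)) /\
    smooth_on [set w | w != 0] (fun w => complex.Im (f w)).

(* Smooth sections of H_{p,q}; only the values of [al] at points [u] of the
   sphere and on vectors in H_u matter. *)
Definition section_Hpq p q (al : forms R n (p + q)) : Prop :=
  smooth_form al /\
  (forall u, Bsphere u -> type_pq u (al u) /\ L_H_adj_zero u (al u)).

End CRforms.

(* Main.v *)
Require Import Defs.
From HB Require Import structures.
From mathcomp Require Import all_boot all_order all_algebra all_fingroup complex.
From mathcomp Require Import all_classical all_reals all_analysis.
From mathcomp Require Import measurable_realfun.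
From mathcomp Require Import ring lra.

Set Implicit Arguments.
Unset Strict Implicit.
Unset Printing Implicit Defensive.

Import Order.TTheory GRing.Theory Num.Theory.
Import numFieldNormedType.Exports.

Local Open Scope classical_set_scope.
Local Open Scope sesquilinear_scope.
Local Open Scope complex_scope.
Local Open Scope ring_scope.

(* Invariance turns the kernel form at (z, u), evaluated on vectors of Bergman
   length at most (1 - |z|^2)^(-1/2), into the value of alpha at u on vectors of
   H_u of length at most 2 F, where F(z, u) = |1 - <u, z>| / (1 - |z|^2).  Both
   halves of the statement therefore follow once the integral of |alpha(u)| F^k
   against vol_z tends to 0 as z tends to the given boundary point.

   The vol_z-measure of {F > T} is the vol_0-measure of a set contained in a
   nonisotropic cap {|1 - <v, p>| < 2 / T} of the sphere.  By K-invariance all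
   caps of the same radius have the same vol_0-measure, and about L^(2n+2)
   disjoint caps of radius about L^(-2) fit in the sphere, so that
   vol_z{F > T} = O(T^(-n-1)).  As k <= n, the part of the integral over {F > T}
   is small for large T, uniformly in z; where F <= T and z is close to the
   boundary point, u is close to it as well, and alpha(u) is small. *)

(** * The Hermitian form and its Lorentzian extension *)

(** The family [vol] enters only through its invariance and total mass, with no density; this is why
    cap masses are bounded by packing. Of the L^(2n+2) caps, L^(2n) come from a grid of mesh about
    1/L in n complex coordinates and L^2 from the phase of the remaining one, the direction
    transverse to H, in which a cap of radius about L^(-2) is that thin. The kernel form depends on
    [lift], a choice of group element, so its measurability in u is never invoked: integrals are
    only compared from above with finite combinations of indicators of measurable sets. These come
    from cutting the sphere at values of F growing like 4^j. On the j-th layer F^k is O(4^(jk)) and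
    the mass is O(4^(-j(n+1))), so k <= n makes the layers sum like a geometric series whose tail
    does not depend on z. *)

Section Hermitian.
Variables (R : realType) (m : nat).
Local Notation C := (Cplx R).
Local Notation vec := 'cV[C]_m.
Implicit Types x y z : vec.

Lemma hermE x y : herm x y = \sum_i x i 0 * (y i 0)^*.
Proof. by rewrite /herm mxE; apply: eq_bigr => i _; rewrite !mxE mulrC. Qed.

Lemma hermDl x y z : herm (x + y) z = herm x z + herm y z.
Proof. by rewrite /herm mulmxDr mxE. Qed.

Lemma hermZl (a : C) x z : herm (a *: x) z = a * herm x z.
Proof. by rewrite /herm -scalemxAr mxE. Qed.

Lemma hermC x y : herm x y = (herm y x)^*.
Proof.
by rewrite !hermE rmorph_sum; apply: eq_bigr => i _; rewrite rmorphM /= conjCK mulrC.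
Qed.

Lemma hermDr x y z : herm z (x + y) = herm z x + herm z y.
Proof. by rewrite hermC hermDl rmorphD /= -!hermC. Qed.

Lemma hermZr (a : C) x z : herm z (a *: x) = a^* * herm z x.
Proof. by rewrite hermC hermZl rmorphM /= -hermC. Qed.

Lemma hermNl x z : herm (- x) z = - herm x z.
Proof. by rewrite -scaleN1r hermZl mulN1r. Qed.

Lemma hermNr x z : herm z (- x) = - herm z x.
Proof. by rewrite hermC hermNl rmorphN /= -hermC. Qed.

Lemma herm0l z : herm 0 z = 0.
Proof. by rewrite -(scale0r 0) hermZl mul0r. Qed.

Lemma herm0r z : herm z 0 = 0.
Proof. by rewrite hermC herm0l rmorph0. Qed.

Lemma herm_conj x : (herm x x)^* = herm x x.
Proof. by rewrite -hermC. Qed.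

Lemma herm_ge0 x : 0 <= herm x x.
Proof. by rewrite hermE sumr_ge0 // => i _; rewrite mul_conjC_ge0. Qed.

Lemma sqr_entry_le_herm x i : `|x i 0| ^+ 2 <= herm x x.
Proof.
rewrite hermE (bigD1 i) //= normCK lerDl sumr_ge0 // => j _.
by rewrite mul_conjC_ge0.
Qed.

Lemma herm_eq0 x : (herm x x == 0) = (x == 0).
Proof.
apply/idP/eqP => [/eqP x0|->]; last by rewrite herm0l.
apply/colP => i; rewrite mxE; apply/eqP; rewrite -normr_eq0 -sqrf_eq0.
by rewrite eq_le exprn_ge0 // andbT -x0 sqr_entry_le_herm.
Qed.

Definition hermE2 := (hermDl, hermDr, hermNl, hermNr, hermZl, hermZr).

Lemma CauchySchwarz_herm x y : `|herm x y| ^+ 2 <= herm x x * herm y y.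
Proof.
have [->|y0] := eqVneq y 0; first by rewrite !herm0r normr0 expr0n mulr0.
have yy : 0 < herm y y by rewrite lt_def herm_ge0 andbT herm_eq0.
have := herm_ge0 (herm y y *: x - herm x y *: y).
rewrite !hermE2 (hermC y x) herm_conj normCK.
rewrite (_ : _ + _ = herm y y * (herm x x * herm y y - herm x y * (herm x y)^*)).
  by rewrite pmulr_rge0 // subr_ge0.
by ring.
Qed.

End Hermitian.

Section LorentzForm.
Variables (R : realType) (n : nat).
Local Notation C := (Cplx R).
Local Notation vec := 'cV[C]_n.+1.
Local Notation bigvec := 'cV[C]_(n.+1 + 1).
Local Notation mat := 'M[C]_(n.+1 + 1).
Local Notation J := (Jform R n).
Implicit Types (x y z : vec) (v w : bigvec) (g : mat).

Definition jform v w : C := (w^t* *m J *m v) 0 0.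

Definition lastc v : C := dsubmx v 0 0.

Lemma lastcE x (a : C) : lastc (col_mx x a%:M) = a.
Proof. by rewrite /lastc col_mxKd mxE eqxx mulr1n. Qed.

Lemma bigvecE v : v = col_mx (usubmx v) (lastc v)%:M.
Proof. by rewrite -[LHS]vsubmxK; congr col_mx; apply/matrixP => i j; rewrite !ord1 [RHS]mxE. Qed.

Lemma lastcZ (a : C) v : lastc (a *: v) = a * lastc v.
Proof. by rewrite /lastc linearZ mxE. Qed.

Lemma jformE v w :
  jform v w = herm (usubmx v) (usubmx w) - lastc v * (lastc w)^*.
Proof.
rewrite /jform /Jform -mulmxA -{1}[v]vsubmxK mul_block_col !mul0mx addr0 add0r.
rewrite mul1mx mulNmx mul1mx -{1}[w]vsubmxK tr_col_mx map_row_mx mul_row_col.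
rewrite mulmxN mxE [X in _ + X]mxE; congr (_ - _).
by rewrite mxE big_ord1 mulrC /lastc !mxE.
Qed.

Lemma jformC v w : jform v w = (jform w v)^*.
Proof. by rewrite !jformE rmorphB rmorphM /= conjCK -hermC mulrC. Qed.

Lemma jformDl v w u : jform (v + w) u = jform v u + jform w u.
Proof. by rewrite /jform mulmxDr mxE. Qed.

Lemma jformZl (a : C) v w : jform (a *: v) w = a * jform v w.
Proof. by rewrite /jform -scalemxAr mxE. Qed.

Lemma jformDr v w u : jform u (v + w) = jform u v + jform u w.
Proof. by rewrite jformC jformDl rmorphD /= -!jformC. Qed.

Lemma jformZr (a : C) v w : jform v (a *: w) = a^* * jform v w.
Proof. by rewrite jformC jformZl rmorphM /= -jformC. Qed.

Lemma jformNl v w : jform (- v) w = - jform v w.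
Proof. by rewrite -scaleN1r jformZl mulN1r. Qed.

Lemma jformNr v w : jform v (- w) = - jform v w.
Proof. by rewrite -scaleN1r jformZr rmorphN1 mulN1r. Qed.

(** Membership in U(n+1,1). The reflections used for transitivity lie here; the determinant is
    normalised only at the end, by [exists_diag]. *)
Definition Jisometry g := g^t* *m J *m g = J.

Lemma jform_isometry g v w : Jisometry g -> jform (g *m v) (g *m w) = jform v w.
Proof.
by move=> gJ; rewrite /jform trmx_mul map_mxM !mulmxA -(mulmxA _ _ J) -(mulmxA _ _ g) gJ.
Qed.

Lemma jform_homog x y : jform (homog x) (homog y) = herm x y - 1.
Proof. by rewrite jformE /homog !col_mxKu !lastcE rmorph1 mulr1. Qed.

Lemma lastc_homog x : lastc (homog x) = 1.
Proof. exact: lastcE. Qed.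

Lemma homog_affine v : lastc v != 0 -> v = lastc v *: homog (affine v).
Proof.
move=> v0; rewrite /homog scale_col_mx /affine scalerA mulfV // scale1r.
by rewrite scale_scalar_mx mulr1 -bigvecE.
Qed.

Lemma affine_homog (a : C) x : a != 0 -> affine (a *: homog x) = x.
Proof.
move=> a0; rewrite /affine -/(lastc _) lastcZ lastc_homog mulr1 linearZ /=.
by rewrite col_mxKu scalerA mulVf // scale1r.
Qed.

End LorentzForm.

Section IsometryGroup.
Variables (R : realType) (n : nat).
Local Notation C := (Cplx R).
Local Notation vec := 'cV[C]_n.+1.
Local Notation bigvec := 'cV[C]_(n.+1 + 1).
Local Notation mat := 'M[C]_(n.+1 + 1).
Local Notation J := (Jform R n).
Implicit Types (x y z : vec) (v w : bigvec) (g : mat).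

Lemma Jform_sqr : J *m J = 1%:M.
Proof.
rewrite /Jform mulmx_block !mulmx0 !mul0mx !addr0 !add0r mul1mx mulmxN mulmx1.
by rewrite opprK -scalar_mx_block.
Qed.

Lemma Jisometry_left g : Jisometry g -> (J *m g^t* *m J) *m g = 1%:M.
Proof. by move=> gJ; rewrite -mulmxA -mulmxA (mulmxA _ J) gJ Jform_sqr. Qed.

Lemma Jisometry_unit g : Jisometry g -> g \in unitmx.
Proof. by move/Jisometry_left/mulmx1_unit => -[]. Qed.

Lemma Jisometry_mul g h : Jisometry g -> Jisometry h -> Jisometry (g *m h).
Proof.
move=> gJ hJ; rewrite /Jisometry trmx_mul map_mxM !mulmxA.
by rewrite -(mulmxA _ _ J) -(mulmxA _ _ g) gJ hJ.
Qed.

Lemma Jisometry1 : Jisometry (1%:M : mat).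
Proof. by rewrite /Jisometry trmx1 map_mx1 mul1mx mulmx1. Qed.

Lemma JisometryP g : (forall v w, jform (g *m v) (g *m w) = jform v w) -> Jisometry g.
Proof.
move=> gJ; apply/matrixP => i j.
have H (A : mat) : ((delta_mx i 0 : bigvec)^t* *m A *m (delta_mx j 0 : bigvec)) 0 0 = A i j.
  rewrite trmx_delta map_delta_mx -rowE -colE !mxE //.
have := gJ (delta_mx j 0) (delta_mx i 0).
by rewrite /jform trmx_mul map_mxM !mulmxA -(mulmxA _ _ J) -(mulmxA _ _ g) !H.
Qed.

(** With w = x - y, equal lengths of x and y give <w, w> = 2 Re <x, w>, which is the condition for
    the complex reflection along w taking x to y to preserve the form. *)
Lemma Jisometry_reflection (x y : bigvec) : jform x x = jform y y ->
  x = y \/ jform x (x - y) != 0 ->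
  exists g, [/\ Jisometry g, g *m x = y &
    forall v, jform v (x - y) = 0 -> g *m v = v].
Proof.
move=> xxyy [xy|d0].
  by exists 1%:M; split => [||v _]; rewrite ?mul1mx //; exact: Jisometry1.
move Ew : (x - y) d0 => w; move Ed : (jform x w) => d d0.
(* The complex reflection v |-> v - (<v, w> / <x, w>) w. *)
pose g : mat := 1%:M - d^-1 *: (w *m w^t* *m J).
have gE v : g *m v = v - (jform v w / d) *: w.
  rewrite /g mulmxBl mul1mx -scalemxAl -!mulmxA; congr (_ - _).
  rewrite (_ : w^t* *m _ = (jform v w)%:M); last first.
    by apply/matrixP => i j; rewrite !ord1 mulmxA [RHS]mxE.
  by rewrite mul_mx_scalar scalerA mulrC.
exists g; split.
- apply: JisometryP => v v'.
  rewrite !gE !jformDl !jformDr !jformNl !jformNr !jformZl !jformZr.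
  rewrite rmorphM /= fmorphV /=. rewrite (jformC w v').
  have dC : d^* != 0 by rewrite conjC_eq0.
  have ww : jform w w = d + d^*.
    rewrite -Ed -jformC -Ew !jformDl !jformDr !jformNl !jformNr xxyy; ring.
  by rewrite ww; field; rewrite d0 dC.
- by rewrite gE Ed mulfV // scale1r -Ew opprB addrC subrK.
- by move=> v vw; rewrite gE vw mul0r scale0r subr0.
Qed.

End IsometryGroup.

(** * Transitivity of SU(n+1,1) on pairs of an interior and a boundary point *)

Section Transitivity.
Variables (R : realType) (n : nat).
Local Notation C := (Cplx R).
Local Notation vec := 'cV[C]_n.+1.
Local Notation bigvec := 'cV[C]_(n.+1 + 1).
Local Notation mat := 'M[C]_(n.+1 + 1).
Local Notation J := (Jform R n).
Local Notation e0 := (basept R n).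
Implicit Types (x y z : vec) (v w : bigvec) (g : mat).

Lemma herm_basept : herm e0 e0 = 1.
Proof.
rewrite hermE (bigD1 0) //= big1 => [|i /negbTE i0]; rewrite !mxE ?i0 ?mul0r //.
by rewrite !eqxx conjC_nat mulr1 addr0.
Qed.

Lemma jformBr x v w : jform (homog x) (v - w) = jform (homog x) v - jform (homog x) w.
Proof. by rewrite jformDr jformNr. Qed.

(** Scaling [homog z] by 1 / sqrt(1 - |z|^2) gives it the length -1 of [homog 0]. The reflection
    degenerates only for z = 0, where the two vectors coincide. *)
Lemma exists_boost z : Bball z ->
  exists g (s : C), [/\ Jisometry g, s != 0 & g *m homog 0 = s *: homog z].
Proof.
rewrite /Bball /= => z1.
have s2 : 0 < 1 - herm z z by rewrite subr_gt0.
pose s := sqrtC (1 - herm z z).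
have s0 : 0 < s by rewrite sqrtC_gt0.
have sE : s ^+ 2 = 1 - herm z z by rewrite sqrtCK.
have sC : s^* = s by apply: CrealP; rewrite gtr0_real.
have s0' : s != 0 by rewrite gt_eqF.
have [||g [gJ gx _]] := @Jisometry_reflection R n (homog 0) (s^-1 *: homog z).
- rewrite jformZl jformZr !jform_homog herm0l fmorphV /= sC sub0r.
  by rewrite -(opprB 1 (herm z z)) -sE; field.
- rewrite jformBr jformZr !jform_homog !herm0l sub0r mulrN1 opprK fmorphV /= sC.
  have [s1|] := eqVneq (-1 + s^-1) 0; [left | by right].
  have s_1 : s = 1.
    by apply: invr_inj; rewrite invr1; apply/eqP; rewrite -subr_eq0 addrC s1.
  have /eqP : herm z z = 0.
    by move: sE; rewrite s_1 expr1n => /eqP; rewrite eq_sym subr_eq addrC -subr_eq subrr => /eqP.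
  by rewrite herm_eq0 => /eqP ->; rewrite s_1 invr1 scale1r.
- by exists g, s^-1; split; rewrite ?invr_eq0.
Qed.

(** The difference of the two boundary lifts has last coordinate 0, hence is orthogonal to
    [homog 0], which the reflection therefore fixes. *)
Lemma exists_rotation u : Bsphere u ->
  exists g, [/\ Jisometry g, g *m homog 0 = homog 0 & g *m homog e0 = homog u].
Proof.
rewrite /Bsphere /= => u1.
have [||g [gJ gx g0]] := @Jisometry_reflection R n (homog e0) (homog u).
- by rewrite !jform_homog u1 herm_basept.
- rewrite jformBr !jform_homog herm_basept subrr sub0r opprB.
  have [d0|] := eqVneq (1 - herm e0 u) 0; [left | by right].
  congr homog; apply/eqP; rewrite -subr_eq0 -herm_eq0 !hermE2 u1 herm_basept.
  have hu : herm e0 u = 1 by apply/eqP; rewrite eq_sym -subr_eq0 d0.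
  by rewrite (hermC u) hu rmorph1; apply/eqP; ring.
- exists g; split => //; apply: g0.
  by rewrite jformBr !jform_homog !herm0l subrr.
Qed.

Lemma det_Jisometry g : Jisometry g -> (\det g)^* * \det g = 1.
Proof.
move=> gJ; have := congr1 determinant gJ; rewrite !det_mulmx det_map_mx det_tr.
have J0 : \det J != 0.
  by rewrite -unitfE -unitmxE; have /mulmx1_unit[] := Jform_sqr R n.
by rewrite mulrAC -{2}(mul1r (\det J)) => /(mulIf J0).
Qed.

(** For n >= 1 there is a coordinate direction orthogonal to both [homog 0] and [homog e0]; scaling
    it by a unit number changes the determinant and moves neither point. *)
Lemma exists_diag (mu : C) : (1 <= n)%N -> mu^* * mu = 1 ->
  exists g, [/\ Jisometry g, \det g = mu, g *m homog 0 = homog 0 &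
                g *m homog e0 = homog e0].
Proof.
move=> n1 mu1.
have m0 : ord_max != 0 :> 'I_n.+1 by rewrite -val_eqE /= -lt0n.
pose d : 'rV[C]_n.+1 := \row_i (if i == ord_max then mu else 1).
pose g : mat := block_mx (diag_mx d) 0 0 1%:M.
have gh x : g *m homog x = homog (diag_mx d *m x).
  by rewrite /g /homog mul_block_col !mul0mx addr0 add0r mul1mx.
exists g; split; last 2 first.
- by rewrite gh mulmx0.
- rewrite gh; congr homog; apply/colP => i; rewrite mul_diag_mx !mxE.
  by case: (eqVneq i 0) => [->|]; rewrite ?mulr0 // eq_sym (negbTE m0) mul1r.
- apply: JisometryP => v w.
  have gE (x : bigvec) : g *m x = col_mx (diag_mx d *m usubmx x) (dsubmx x).
    by rewrite -{1}[x]vsubmxK /g mul_block_col !mul0mx addr0 add0r mul1mx.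
  rewrite !jformE /lastc !gE !col_mxKu !col_mxKd; congr (_ - _).
  rewrite !hermE; apply: eq_bigr => i _; rewrite !mul_diag_mx !mxE rmorphM /=.
  rewrite mulrACA; case: ifP => _; rewrite ?rmorph1 ?mulr1 ?mul1r //.
  by rewrite [mu * _]mulrC mu1 mul1r.
- rewrite /g det_ublock det1 mulr1 det_diag (bigD1 ord_max) //= mxE eqxx.
  by rewrite big1 ?mulr1 // => i /negbTE; rewrite mxE => ->.
Qed.

(** The form is positive definite on vectors with last coordinate 0. Consequently the denominators
    of the action never vanish on the closed ball. *)
Lemma lastc_neq0 v : jform v v <= 0 -> v != 0 -> lastc v != 0.
Proof.
move=> vv; apply: contra_neq => v0; move: vv.
rewrite jformE v0 mul0r subr0 => vv.
have /eqP : herm (usubmx v) (usubmx v) = 0 by apply/eqP; rewrite eq_le vv herm_ge0.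
by rewrite herm_eq0 => /eqP u0; rewrite (bigvecE v) u0 v0 raddf0 col_mx0.
Qed.

Lemma Jisometry_neq0 g v : Jisometry g -> v != 0 -> g *m v != 0.
Proof.
move=> /Jisometry_unit gU; apply: contra_neq => gv.
by rewrite -(mulKmx gU v) gv mulmx0.
Qed.

Lemma homog_neq0 x : homog x != 0.
Proof.
apply/eqP => x0; have := lastc_homog x; rewrite x0 /lastc linear0 mxE => /eqP.
by rewrite eq_sym oner_eq0.
Qed.

Lemma lastc_homog_neq0 g x : Jisometry g -> herm x x <= 1 -> lastc (g *m homog x) != 0.
Proof.
move=> gJ x1; apply: lastc_neq0; last exact: Jisometry_neq0 (homog_neq0 _).
by rewrite jform_isometry // jform_homog subr_le0.
Qed.

Lemma homog_act g x : Jisometry g -> herm x x <= 1 ->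
  g *m homog x = lastc (g *m homog x) *: homog (Defs.act g x).
Proof. by move=> gJ x1; apply: homog_affine; apply: lastc_homog_neq0. Qed.

(** The form evaluated on the lifts before and after applying g. For x = y = 0 it determines the
    modulus of the denominator at the origin; for x on the sphere and y = 0 it relates 1 - <u, z> to
    the two denominators. *)
Lemma herm_act g x y : Jisometry g -> herm x x <= 1 -> herm y y <= 1 ->
  lastc (g *m homog x) * (lastc (g *m homog y))^*
    * (1 - herm (Defs.act g x) (Defs.act g y)) = 1 - herm x y.
Proof.
move=> gJ x1 y1; have H := jform_isometry (homog x) (homog y) gJ.
rewrite (homog_act gJ x1) (homog_act gJ y1) jformZl jformZr !jform_homog mulrA in H.
by rewrite -[1 - herm x y]opprB -H -mulrN opprB.
Qed.

Lemma Jisometry_inv g : Jisometry g -> Jisometry (invmx g).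
Proof.
move=> gJ; apply: JisometryP => v w.
by rewrite -(jform_isometry _ _ gJ) !mulKVmx ?Jisometry_unit.
Qed.

Lemma SU_transitive z u : (1 <= n)%N -> Bball z -> Bsphere u ->
  exists g, [/\ SU g, Defs.act g 0 = z & Defs.act g e0 = u].
Proof.
move=> n1 zB uS.
have [h [s [hJ s0 hz]]] := exists_boost zB.
have u1 : herm u u <= 1 by rewrite uS.
pose v := invmx h *m homog u.
have hV := Jisometry_inv hJ.
have v0 : lastc v != 0 by apply: lastc_homog_neq0.
have u'S : Bsphere (affine v).
  rewrite /Bsphere /=; have := jform_isometry (homog u) (homog u) hV.
  rewrite -/v {1 2}(homog_affine v0) jformZl jformZr !jform_homog uS subrr.
  move/eqP; rewrite !mulf_eq0 conjC_eq0 (negbTE v0) /= subr_eq0 => /eqP //.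
have [r [rJ r0 re]] := exists_rotation u'S.
have hrJ := Jisometry_mul hJ rJ.
have mu1 : ((\det (h *m r))^-1)^* * (\det (h *m r))^-1 = 1.
  by rewrite fmorphV /= -invfM det_Jisometry // invr1.
have [d [dJ dd d0 de]] := exists_diag n1 mu1.
exists (h *m r *m d); split.
- split; first exact: Jisometry_mul.
  rewrite det_mulmx dd mulfV //.
  by apply/eqP => D0; have /eqP := det_Jisometry hrJ; rewrite D0 mulr0 eq_sym oner_eq0.
- by rewrite /Defs.act -!mulmxA d0 r0 hz affine_homog.
- rewrite /Defs.act -!mulmxA de re -[homog (affine v)]scale1r -(mulVf v0) -scalerA.
  rewrite -homog_affine // -scalemxAr mulKVmx ?Jisometry_unit //.
  by rewrite affine_homog // invr_eq0.
Qed.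

End Transitivity.

(** * The kernel form *)

Section KernelBound.
Variables (R : realType) (n : nat).
Local Notation C := (Cplx R).
Local Notation vec := 'cV[C]_n.+1.
Local Notation bigvec := 'cV[C]_(n.+1 + 1).
Local Notation mat := 'M[C]_(n.+1 + 1).
Local Notation e0 := (basept R n).
Implicit Types (x y z u : vec) (g : mat).

(** The sublevel sets in z, for u fixed on the sphere, are the admissible (Koranyi) approach regions
    with vertex u. *)
Definition aperture z u : C := `|1 - herm u z| / (1 - herm z z).

Lemma lift_spec z u : (1 <= n)%N -> Bball z -> Bsphere u ->
  [/\ SU (Defs.lift z u), Defs.act (Defs.lift z u) 0 = z
    & Defs.act (Defs.lift z u) e0 = u].
Proof. by move=> n1 zB uS; have := xgetPex 1%:M (SU_transitive n1 zB uS). Qed.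

Lemma sqr_lastc_origin g : Jisometry g ->
  lastc (g *m homog 0) * (lastc (g *m homog 0))^*
    * (1 - herm (Defs.act g 0) (Defs.act g 0)) = 1.
Proof. by move=> gJ; rewrite herm_act // herm0l ?subr0 // ler01. Qed.

(** The lift (x, 0) keeps its length under g^-1, and its new last coordinate is found by pairing
    with [homog 0]. This gives |x|^2 + |d|^2 |<x, z>|^2, to be multiplied by |d|^2 = 1 / (1 -
    |z|^2). *)
Lemma bergman_dact_inv g x : Jisometry g ->
  let y := dact (invmx g) (Defs.act g 0) x in
  herm y y = bergman (Defs.act g 0) x x.
Proof.
move=> gJ y; set z := Defs.act g 0 in y *.
pose d := lastc (g *m homog 0); pose v := invmx g *m col_mx x 0.
have o1 : herm (0 : vec) 0 <= 1 by rewrite herm0l ler01.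
have d0 : d != 0 := lastc_homog_neq0 gJ o1.
have gz : invmx g *m homog z = d^-1 *: homog 0.
  rewrite -(mulKmx (Jisometry_unit gJ) (homog 0)) (homog_act gJ o1) -/z -/d.
  by rewrite -scalemxAr scalerA mulVf // scale1r.
have yE : y = d *: usubmx v.
  rewrite /y /dact gz -/v /daffine -!/(lastc _) lastcZ lastc_homog mulr1 invrK.
  by rewrite /homog scale_col_mx col_mxKu !scaler0 subr0.
have vv : jform v v = herm x x.
  rewrite jform_isometry; last exact: Jisometry_inv.
  by rewrite jformE !col_mxKu /lastc !col_mxKd !mxE mul0r subr0.
have vz : lastc v = - (d^* * herm x z).
  have <- : - jform v (homog 0) = lastc v.
    by rewrite jformE /homog col_mxKu herm0r -/(homog _) lastc_homog rmorph1 mulr1 sub0r opprK.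
  rewrite -(jform_isometry _ _ gJ) mulKVmx ?Jisometry_unit // (homog_act gJ o1).
  rewrite jformZr -/d -/z jformE /homog !col_mxKu -/(homog _) lastc_homog.
  by rewrite {1}/lastc col_mxKd mxE mul0r subr0.
have ee : herm (usubmx v) (usubmx v) = herm x x + lastc v * (lastc v)^*.
  by rewrite -vv jformE subrK.
have dd : d * d^* = (1 - herm z z)^-1.
  have H := sqr_lastc_origin gJ; rewrite -/d -/z in H.
  have z0 : 1 - herm z z != 0.
    by apply/eqP => z0; move: H; rewrite z0 mulr0 => /eqP; rewrite eq_sym oner_eq0.
  by apply: (mulIf z0); rewrite H mulVf.
rewrite yE hermZl hermZr ee vz rmorphN rmorphM /= conjCK -hermC /bergman.
rewrite expr2 invfM -dd; ring.
Qed.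

(** [homog e0] is an eigenvector of [gradE] for the eigenvalue 1, so only the term [proj0 X projp]
    survives. Passing to g_{-1} thus projects y orthogonally to H at the base point. *)
Lemma grm1_qelt y :
  grm1 (qelt y) *m homog e0 = col_mx (y - herm y e0 *: e0) 0.
Proof.
have gE x (a : C) : gradE R n *m col_mx x a%:M = col_mx (a *: e0) (herm x e0)%:M.
  rewrite /gradE mul_block_col !mul0mx addr0 add0r mul_mx_scalar.
  by congr col_mx; apply/matrixP => i j; rewrite !ord1 [RHS]mxE.
have g0 : gradE R n *m homog e0 = homog e0.
  by rewrite /homog gE herm_basept scale1r.
have p0 : projp R n *m homog e0 = homog e0.
  rewrite /projp -scalemxAl mulmxDl -mulmxA !g0 -mulr2n -(scaler_nat 2 (homog e0)) scalerA.
  by rewrite mulVf ?scale1r // pnatr_eq0.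
have z0 : proj0 R n *m homog e0 = 0.
  by rewrite /proj0 mulmxBl mul1mx -mulmxA !g0 subrr.
have qE : qelt y *m homog e0 = col_mx y ((herm y e0)^*)%:M.
  rewrite /qelt /homog mul_block_col !mul0mx addr0 add0r mulmx1 -hermC.
  by congr col_mx; apply/matrixP => i j; rewrite !ord1 [RHS]mxE.
rewrite /grm1 mulmxDl -!mulmxA p0 z0 !mulmx0 addr0 qE.
rewrite /proj0 mulmxBl mul1mx -mulmxA !gE hermZl herm_basept mulr1.
by rewrite opp_col_mx add_col_mx subrr.
Qed.

(** The Cartan involution is -1 on q; this is the source of the factor 2 in the bound 2 F. *)
Lemma cartan_qelt y : cartan (qelt y) - qelt y = qelt (- (y + y)).
Proof.
rewrite /cartan /qelt tr_block_mx map_block_mx !trmx0 !map_mx0 trmxCK.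
rewrite !opp_block_mx add_block_mx !oppr0 !addr0 -!opprD; congr block_mx.
by apply/rowP => i; rewrite !mxE rmorphN rmorphD.
Qed.

(** (x, 0) is orthogonal to [homog e0], so its image is orthogonal to [homog u]; this forces the
    projected vector into H_u. On H the differential is a similarity of ratio 1 / |c|. *)
Lemma daffine_boundary g u x : Jisometry g -> Bsphere u -> Defs.act g e0 = u ->
  herm x e0 = 0 ->
  let c := lastc (g *m homog e0) in
  let zeta := daffine (g *m homog e0) (g *m col_mx x 0) in
  herm zeta u = 0 /\ c * c^* * herm zeta zeta = herm x x.
Proof.
move=> gJ u1 gu xe c zeta; rewrite /Bsphere /= in u1.
have e1 : herm e0 e0 <= 1 by rewrite herm_basept.
have c0 : c != 0 := lastc_homog_neq0 gJ e1.
have gE : g *m homog e0 = c *: homog u by rewrite (homog_act gJ e1) gu.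
pose v := g *m col_mx x 0.
have vv : herm (usubmx v) (usubmx v) = herm x x + lastc v * (lastc v)^*.
  apply/eqP; rewrite -subr_eq -jformE jform_isometry //.
  by rewrite jformE !col_mxKu /lastc !col_mxKd !mxE mul0r subr0.
have vu : herm (usubmx v) u = lastc v.
  have : jform v (g *m homog e0) = 0.
    rewrite jform_isometry // jformE /homog !col_mxKu xe /lastc !col_mxKd.
    by rewrite !mxE mul0r subr0.
  rewrite gE jformZr jformE /homog !col_mxKu -/(homog _) lastc_homog rmorph1 mulr1.
  by move/eqP; rewrite mulf_eq0 conjC_eq0 (negbTE c0) /= subr_eq0 => /eqP.
have zE : zeta = c^-1 *: (usubmx v - lastc v *: u).
  rewrite /zeta /daffine -/v -/(lastc v) -/(lastc (g *m homog e0)) -/c gE.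
  rewrite /homog scale_col_mx col_mxKu.
  rewrite scalerBr !scalerA.
  by have -> : lastc v / c ^+ 2 * c = c^-1 * lastc v by field.
clearbody zeta v.
split.
  by rewrite zE !hermE2 vu u1 mulr1 subrr mulr0.
have cC : c^* != 0 by rewrite conjC_eq0.
rewrite zE !hermE2 u1 vv vu (hermC u) vu fmorphV /=; field.
by rewrite c0 cC.
Qed.

(* To be read with D = 1 - |z|^2, N = 1 - <u, z>, and with d and c the
   denominators of the action of g at the origin and at the base point. *)
Lemma boundary_scaling_le (c d D N Z W : C) : 0 < D -> d * d^* * D = 1 ->
  c * d^* * N = 1 -> c * c^* * Z = W -> W <= 4%:R * D^-1 ->
  Z <= (2%:R * (`|N| / D)) ^+ 2.
Proof.
move=> D0 dD cN cZ WD.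
have D0' : D != 0 by rewrite gt_eqF.
have dd : d * d^* = D^-1 by apply: (mulIf D0'); rewrite dD mulVf.
have cN' : c^* * d * N^* = 1.
  by rewrite -[RHS](rmorph1 Num.conj) -cN !rmorphM /= conjCK.
have -> : Z = D^-1 * `|N| ^+ 2 * W.
  rewrite -cZ -dd normCK.
  transitivity ((c * d^* * N) * (c^* * d * N^* ) * Z); last by ring.
  by rewrite cN cN' !mul1r.
rewrite (_ : (_ * (_ / _)) ^+ 2 = D^-1 * `|N| ^+ 2 * (4%:R * D^-1)); last by field.
by apply: ler_wpM2l => //; rewrite mulr_ge0 ?exprn_ge0 // invr_ge0 ltW.
Qed.

Lemma kernel_form_bound k (al : forms R n k) z u (Xi : 'M[C]_(n.+1, k)) :
  (1 <= n)%N -> Bball z -> Bsphere u ->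
  (forall j, bergman z (col j Xi) (col j Xi) <= (1 - herm z z)^-1) ->
  exists Z : 'M[C]_(n.+1, k),
    [/\ kernel_form al z u Xi = al u Z, inH u Z &
      forall j, herm (col j Z) (col j Z) <= (2%:R * aperture z u) ^+ 2].
Proof.
move=> n1 zB uS Xib.
have [[gJ _] gz gu] := lift_spec n1 zB uS.
set g := Defs.lift z u in gJ gz gu.
pose y j := dact (invmx g) z (col j Xi).
pose w j := - (y j + y j) - herm (- (y j + y j)) e0 *: e0.
pose zeta j := daffine (g *m homog e0) (g *m col_mx (w j) 0).
have we j : herm (w j) e0 = 0.
  rewrite /w; move: (- (y j + y j)) => x.
  by rewrite hermDl hermNl hermZl herm_basept mulr1 subrr.
have zetaP j := daffine_boundary gJ uS gu (we j).
exists (\matrix_(i, j) zeta j i 0); split.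
- rewrite /kernel_form -/g /iota_form /pullback gu; apply: (f_equal (al u)).
  apply/matrixP => i j.
  by rewrite [LHS]mxE [RHS]mxE cartan_qelt -mulmxA grm1_qelt.
- apply/matrixP => i j; have [zu _] := zetaP j.
  rewrite ord1 [RHS]mxE -zu /herm [LHS]mxE [RHS]mxE.
  by apply: eq_bigr => l _; congr (_ * _); rewrite mxE.
- move=> j; have -> : col j (\matrix_(i, j) zeta j i 0) = zeta j.
    by apply/colP => i; rewrite mxE mxE.
  have [_] := zetaP j; rewrite -/(zeta j).
  have e1 : herm e0 e0 <= 1 by rewrite herm_basept.
  have o1 : herm (0 : vec) 0 <= 1 by rewrite herm0l ler01.
  have H0 := sqr_lastc_origin gJ; have H1 := herm_act gJ e1 o1.
  rewrite gz in H0; rewrite gz gu herm0r subr0 in H1.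
  move=> Hc.
  have z1 : 0 < 1 - herm z z by rewrite subr_gt0.
  apply: (boundary_scaling_le z1 H0 H1 Hc).
  apply: le_trans (_ : 4%:R * herm (y j) (y j) <= _); last first.
    by rewrite ler_pM2l ?ltr0n // /y -gz bergman_dact_inv // gz.
  rewrite /w; move: (y j) => x; rewrite !hermE2 herm_basept (hermC e0).
  set a := herm x e0; set b := herm x x.
  (* The projection shortens -2y: the loss in squared length is 4 |<y, e0>|^2. *)
  rewrite -subr_ge0 (_ : _ - _ = 4%:R * (a * a^*)).
    by rewrite mulr_ge0 ?ler0n // mul_conjC_ge0.
  by rewrite rmorphN rmorphD /=; ring.
Qed.

End KernelBound.

(** * Real coefficients of a form of type (p,q) *)

Section Multilinear.
Variables (R : realType) (n : nat).
Local Notation C := (Cplx R).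
Local Notation vec := 'cV[C]_n.+1.

(** Multilinearity in the columns of t. The sum runs over all maps f, not only the increasing ones
    of the Cauchy-Binet formula. *)
Lemma det_mulmx_expand (F : comPzRingType) k N (B : 'M[F]_(k, N)) (t : 'M[F]_(N, k)) :
  \det (B *m t) = \sum_(f : {ffun 'I_k -> 'I_N})
    (\prod_j t (f j) j) * \det (colsub f B).
Proof.
rewrite -det_tr [LHS]/(\det _).
under eq_bigr => s _.
  under eq_bigr => j _ do rewrite !mxE.
  rewrite bigA_distr_bigA /= mulr_sumr.
  over.
rewrite exchange_big /=; apply: eq_bigr => f _.
rewrite -det_tr [in RHS]/determinant mulr_sumr; apply: eq_bigr => s _.
rewrite big_split /= mulrA mulrC; congr (_ * (_ * _)).
by apply: eq_bigr => j _; rewrite !mxE.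
Qed.

(** Real multilinearity on H_u, extracted from the determinants in [type_pq]. The entries of t must
    be real because the q conjugate linear factors would conjugate them. *)
Lemma type_pq_expand p q u (phi : 'M[C]_(n.+1, p + q) -> C) N
    (E : 'M[C]_(n.+1, N)) (t : 'M[C]_(N, p + q)) :
  type_pq u phi -> inH u E -> map_mx Num.conj t = t ->
  phi (E *m t) = \sum_(f : {ffun 'I_(p + q) -> 'I_N})
    (\prod_j t (f j) j) * phi (colsub f E).
Proof.
move=> [m [c [a [b phiE]]]] EH tR.
have subE (f : 'I_(p + q) -> 'I_N) : inH u (colsub f E).
  apply/matrixP => i j; transitivity ((u^t* *m E) i (f j)).
    by rewrite [LHS]mxE [RHS]mxE; apply: eq_bigr => l _; rewrite !mxE.
  by rewrite EH !mxE.
rewrite phiE; last by rewrite /inH mulmxA EH mul0mx.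
under eq_bigr => j _.
  rewrite map_mxM tR !mulmxA -mul_col_mx det_mulmx_expand mulr_sumr.
  over.
rewrite exchange_big /=; apply: eq_bigr => f _.
rewrite phiE // mulr_sumr; apply: eq_bigr => j _.
rewrite mulrCA; congr (_ * (_ * \det _)).
apply/matrixP => i l; rewrite !mxE; case: splitP => r _; rewrite !mxE;
  by apply: eq_bigr => o _; rewrite !mxE.
Qed.

Definition realbasis : 'M[C]_(n.+1, n.+1 + n.+1) := row_mx 1%:M ('i *: 1%:M).

Definition coeff_size k (al : forms R n k) (u : vec) : C :=
  \sum_(f : {ffun 'I_k -> 'I_(n.+1 + n.+1)})
    `|al u (projH u (colsub f realbasis))|.

Lemma projH_inH k u (Xi : 'M[C]_(n.+1, k)) : Bsphere u -> inH u (projH u Xi).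
Proof.
rewrite /Bsphere /= => u1; rewrite /inH /projH u1 invr1 scale1r mulmxBr.
rewrite !mulmxA (_ : u^t* *m u = 1%:M) ?mul1mx ?subrr //.
by apply/matrixP => i j; rewrite !ord1 [RHS]mxE.
Qed.

Lemma form_coeff_bound p q (al : forms R n (p + q)) u (r : C)
    (Z : 'M[C]_(n.+1, p + q)) :
  Bsphere u -> type_pq u (al u) -> 0 <= r -> inH u Z ->
  (forall j, herm (col j Z) (col j Z) <= r ^+ 2) ->
  `|al u Z| <= coeff_size al u * r ^+ (p + q).
Proof.
move=> uS alu r0 ZH Zr.
pose t : 'M[C]_(n.+1 + n.+1, p + q) :=
  col_mx (map_mx (fun c => 'Re c) Z) (map_mx (fun c => 'Im c) Z).
have Et : realbasis *m t = Z.
  rewrite mul_row_col mul1mx -scalemxAl mul1mx; apply/matrixP => i j.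
  by rewrite !mxE -Crect.
have tR : map_mx Num.conj t = t.
  apply/matrixP => i j; rewrite !mxE; case: splitP => l _; rewrite !mxE.
    exact/CrealP/Creal_Re.
  exact/CrealP/Creal_Im.
have tr i j : `|t i j| <= r.
  have Zij l : `|Z l j| <= r.
    rewrite -(@ler_pXn2r _ 2) ?nnegrE ?normr_ge0 //.
    by apply: le_trans (Zr j); have := sqr_entry_le_herm (col j Z) l; rewrite mxE.
  rewrite mxE; case: splitP => l _; rewrite mxE; apply: le_trans (Zij l).
    by rewrite leif_normC_Re_Creal.
  rewrite -(@ler_pXn2r _ 2) ?nnegrE ?normr_ge0 // (normC2_Re_Im (Z _ j)).
  by rewrite real_normK ?Creal_Im // lerDr -realEsqr Creal_Re.
(* Z already lies in H_u, so projecting its expansion in the real basis does not change it. *)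
have -> : Z = projH u realbasis *m t.
  rewrite /projH mulmxBl Et -scalemxAl -!mulmxA Et ZH !mulmx0.
  by rewrite scaler0 subr0.
rewrite (type_pq_expand alu) //; last exact: projH_inH.
rewrite /coeff_size mulr_suml; apply: le_trans (ler_norm_sum _ _ _) _.
apply: ler_sum => f _; rewrite normrM mulrC.
have -> : colsub f (projH u realbasis) = projH u (colsub f realbasis).
  apply/matrixP => i j; rewrite !mxE !big_ord1 !mxE; congr (_ - _ * (_ * _)).
  by apply: eq_bigr => l _; rewrite !mxE.
apply: ler_wpM2l => //; rewrite normr_prod.
apply: le_trans (ler_prod _ (fun j _ => _ : 0 <= `|t (f j) j| <= r)) _.
  by move=> j _; rewrite normr_ge0 tr.
by rewrite prodr_const card_ord.
Qed.

End Multilinear.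

Section RealPart.
Variable R : realType.
Local Notation C := (Cplx R).
Implicit Types (z : C) (x y : R).

Lemma ler_toC x y : (toC x <= toC y) = (x <= y).
Proof. exact: lecR. Qed.

Lemma ltr_toC x y : (toC x < toC y) = (x < y).
Proof. exact: ltcR. Qed.

Lemma toC_ge0 x : (0 <= toC x) = (0 <= x).
Proof. exact: ler0c. Qed.

Lemma toC_Re z : z \is Num.real -> toC (complex.Re z) = z.
Proof. exact: RRe_real. Qed.

Lemma normr_toC z : `|z| = toC (Num.sqrt (complex.Re z ^+ 2 + complex.Im z ^+ 2)).
Proof. exact: normc_def. Qed.

Lemma norm_Re_le z : toC `|complex.Re z| <= `|z|.
Proof. by rewrite normr_toC ler_toC -sqrtr_sqr ler_wsqrtr // lerDl sqr_ge0. Qed.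

Lemma norm_Im_le z : toC `|complex.Im z| <= `|z|.
Proof. by rewrite normr_toC ler_toC -sqrtr_sqr ler_wsqrtr // lerDr sqr_ge0. Qed.

Lemma norm_le_Re_Im z : `|z| <= toC (`|complex.Re z| + `|complex.Im z|).
Proof.
rewrite normr_toC ler_toC.
rewrite -[leRHS]ger0_norm ?addr_ge0 // -[leRHS]sqrtr_sqr ler_wsqrtr //.
by rewrite sqrrD !real_normK ?num_real // lerD2r lerDl mulrn_wge0 ?mulr_ge0.
Qed.

Lemma toCD x y : toC (x + y) = toC x + toC y.
Proof. exact: (rmorphD (real_complex R)). Qed.

Lemma toCM x y : toC (x * y) = toC x * toC y.
Proof. exact: (rmorphM (real_complex R)). Qed.

Lemma toCX x m : toC (x ^+ m) = toC x ^+ m.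
Proof. exact: (rmorphXn (real_complex R)). Qed.

Lemma toC_nat m : toC (m%:R : R) = m%:R.
Proof. exact: (rmorph_nat (real_complex R)). Qed.

Lemma toC_sum (I : finType) (F : I -> R) : toC (\sum_i F i) = \sum_i toC (F i).
Proof. exact: (rmorph_sum (real_complex R)). Qed.

End RealPart.

(** * Uniform bounds for the coefficients on the sphere *)

Section Coefficients.
Variables (R : realType) (n : nat).
Local Notation C := (Cplx R).
Local Notation vec := 'cV[C]_n.+1.
Local Notation N := (n.+1 + n.+1)%N.

Lemma trmx_continuous m : continuous (fun r : 'rV[R]_m => r^T : 'cV[R]_m).
Proof.
move=> r s /= /nbhs_ballP[e e0 es]; apply/nbhs_ballP; exists e => // r' [? rr'].
by apply: es; split => // i j; rewrite !mxE; exact: rr'.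
Qed.

Definition toReal (u : vec) : 'cV[R]_N :=
  col_mx (map_mx (@complex.Re R) u) (map_mx (@complex.Im R) u).

Lemma toRealK u : ofReal (toReal u) = u.
Proof.
by apply/colP => i; rewrite !mxE (unsplitK (inl i)) (unsplitK (inr i)) !mxE; case: (u i 0).
Qed.

Lemma herm_ofReal (w : 'cV[R]_N) :
  herm (ofReal w) (ofReal w) = toC (\sum_i w i 0 ^+ 2).
Proof.
rewrite big_split_ord /= toCD !toC_sum -big_split hermE; apply: eq_bigr => i _ /=.
rewrite -normCK normr_toC -toCX sqr_sqrtr ?addr_ge0 ?sqr_ge0 // -toCD.
by rewrite /ofReal mxE.
Qed.

(** A majorant of [coeff_size] on the sphere, assembled from the homogeneous extensions in
    [smooth_form]; it is therefore continuous off the origin. *)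
Definition coeff_real k (al : forms R n k) (w : 'cV[R]_N) : R :=
  let z := ofReal w in
  \sum_(f : {ffun 'I_k -> 'I_N})
    (`|complex.Re (al ((sqrtC (herm z z))^-1 *: z) (projH z (colsub f (realbasis R n))))|
    + `|complex.Im (al ((sqrtC (herm z z))^-1 *: z) (projH z (colsub f (realbasis R n))))|).

Lemma coeff_size_le k (al : forms R n k) (w : 'cV[R]_N) : Bsphere (ofReal w) ->
  coeff_size al (ofReal w) <= toC (coeff_real al w).
Proof.
rewrite /Bsphere /= => w1; rewrite /coeff_real w1 sqrtC1 invr1 scale1r toC_sum.
by apply: ler_sum => f _; exact: norm_le_Re_Im.
Qed.

Lemma coeff_real_continuous k (al : forms R n k) (w : 'cV[R]_N) :
  smooth_form al -> w != 0 -> {for w, continuous (coeff_real al)}.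
Proof.
move=> als w0.
have H (f : {ffun 'I_k -> 'I_N}) := als (colsub f (realbasis R n)).
pose g (f : {ffun 'I_k -> 'I_N}) (w : 'cV[R]_N) : C :=
  let z := ofReal w in
  al ((sqrtC (herm z z))^-1 *: z) (projH z (colsub f (realbasis R n))).
have gc f : (fun w => `|complex.Re (g f w)| + `|complex.Im (g f w)|) @ w -->
    `|complex.Re (g f w)| + `|complex.Im (g f w)|.
  (* The empty list of directions in [smooth_on] yields differentiability of the function itself. *)
  have [/(_ [::] w w0)/= Hr /(_ [::] w w0)/= Hi] := H f.
  have {}Hr := cvg_norm (differentiable_continuous Hr).
  have {}Hi := cvg_norm (differentiable_continuous Hi).
  exact: (cvgD (Hr _) (Hi _)).
exact: (@cvg_big _ _ _ 0 xpredT (@add_continuous R) _ (nbhs w) _ _ _ _ (fun f _ => gc f)).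
Qed.

(** The majorant [coeff_real] is continuous on the compact sphere. The transposes serve to express
    the sphere as a set of row vectors, to which the extreme value theorem is applied. *)
Lemma coeff_size_bounded k (al : forms R n k) : smooth_form al ->
  exists2 B : R, 0 <= B & forall u, Bsphere u -> coeff_size al u <= toC B.
Proof.
move=> als.
pose K : set 'rV[R]_N := [set r | \sum_i r 0 i ^+ 2 = 1].
have KS r : K r <-> Bsphere (ofReal r^T).
  rewrite /K /Bsphere /= herm_ofReal.
  have -> : \sum_i r^T i 0 ^+ 2 = \sum_i r 0 i ^+ 2.
    by apply: eq_bigr => i _; rewrite mxE.
  by split => [->|/(@complexI R) //].
have cK : compact K.
  have Mnco : compact [set v : 'rV[R]_N | forall i, v ord0 i \in `[(-1 : R), 1]].
    apply: (@rV_compact _  _ (fun=> `[(-1 : R), 1]%classic)).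
    by move=> _; apply: segment_compact.
  apply: subclosed_compact _ Mnco _ => [|r rK i].
    apply: (@closed_comp _ _ (fun r : 'rV[R]_N => \sum_i r 0 i ^+ 2) [set 1 : R]).
      move=> r _; move: r; apply: continuous_big => [|i _ r]; first exact: add_continuous.
      have H := @coord_continuous R 1 N 0 i r.
      exact: (cvgM H H).
    exact: closed_eq.
  rewrite in_itv /= -ler_norml -(@expr_le1 _ 2) // real_normK ?num_real //.
  by rewrite -rK (bigD1 i) //= lerDl sumr_ge0 // => j _; exact: sqr_ge0.
have K0 : K !=set0.
  exists (toReal (basept R n))^T; apply/KS; rewrite trmxK toRealK.
  exact: herm_basept.
have [|c cK' cmax] := EVT_max_rV (f := fun r => coeff_real al r^T) K0 cK.
  apply: continuous_in_subspaceT => r; rewrite inE => /KS rS.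
  apply: (@continuous_comp _ _ _ (fun r : 'rV[R]_N => r^T) (coeff_real al)).
    exact: trmx_continuous.
  apply: coeff_real_continuous => //; apply/eqP => r0.
  move: rS; rewrite r0 /Bsphere /= herm_ofReal big1 => [|i _]; last by rewrite mxE expr0n.
  by move/eqP; rewrite eq_sym oner_eq0.
exists (coeff_real al c^T).
  by apply: sumr_ge0 => f _; rewrite addr_ge0.
move=> u uS; rewrite -(toRealK u); apply: le_trans (coeff_size_le _ _) _.
  by rewrite toRealK.
rewrite ler_toC -[X in coeff_real al X]trmxK; apply: cmax.
by rewrite inE; apply/KS; rewrite trmxK toRealK.
Qed.

Lemma coeff_size_small k (al : forms R n k) (u0 : vec) (e : R) :
  smooth_form al -> Bsphere u0 -> (forall Xi, inH u0 Xi -> al u0 Xi = 0) -> 0 < e ->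
  exists2 d : R, 0 < d & forall u, Bsphere u ->
    herm (u - u0) (u - u0) < toC d -> coeff_size al u <= toC e.
Proof.
move=> als uS al0 e0.
have w0 : toReal u0 != 0.
  apply/eqP => r0; move: uS; rewrite -(toRealK u0) r0 /Bsphere /= herm_ofReal big1.
    by move/eqP; rewrite eq_sym oner_eq0.
  by move=> i _; rewrite mxE expr0n.
have c0 : coeff_real al (toReal u0) = 0.
  rewrite /coeff_real toRealK uS sqrtC1 invr1 scale1r big1 // => f _.
  by rewrite al0 ?normr0 ?addr0 //; exact: projH_inH.
have /cvgrPdist_lt /(_ e e0) /nbhs_ballP [d d0 dP] := coeff_real_continuous als w0.
exists (d ^+ 2); first by rewrite exprn_gt0.
move=> u u1 uu; rewrite -(toRealK u); apply: le_trans (coeff_size_le _ _) _.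
  by rewrite toRealK.
rewrite ler_toC; have := dP (toReal u); rewrite c0 sub0r normrN /= => H.
apply: le_trans (ler_norm _) (ltW (H _)); split => // i j; rewrite ord1 /ball /=.
have E l : `|u0 l 0 - u l 0| < toC d.
  rewrite -(@ltr_pXn2r _ 2) ?nnegrE //; last by rewrite toC_ge0 ltW.
  rewrite -(toCX d); apply: le_lt_trans uu; rewrite distrC.
  by have := sqr_entry_le_herm (u - u0) l; rewrite !mxE.
rewrite !mxE; case: splitP => l _; rewrite !mxE -ltr_toC.
  by apply: le_lt_trans (E l); have := norm_Re_le (u0 l 0 - u l 0); rewrite raddfB.
by apply: le_lt_trans (E l); have := norm_Im_le (u0 l 0 - u l 0); rewrite raddfB.
Qed.

End Coefficients.

(** * Packing of caps *)

Section Grid.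
Variables (R : realType) (n L : nat).
Local Notation C := (Cplx R).
Local Notation vec := 'cV[C]_n.+1.

(* The points of the sphere with last n coordinates on a grid of mesh about
   1 / L and with the phase of the first coordinate on a grid of mesh about
   1 / L^2: caps of radius about 1 / L^2 around them are disjoint. *)
Definition gridindex : finType :=
  ({ffun 'I_n -> 'I_L * 'I_L} * 'I_(L ^ 2))%type.

(** The denominator keeps the squared length of the tail below 1/8, so that the first coordinate
    stays away from 0. *)
Definition grid_tail (i : gridindex) (j : 'I_n) : C :=
  ((i.1 j).1%:R + 'i * (i.1 j).2%:R) / (4 * n.+1 * L)%N%:R.

Definition grid_rho (i : gridindex) : C :=
  sqrtC (1 - \sum_j `|grid_tail i j| ^+ 2).

Definition grid_phase (i : gridindex) : C :=
  let y := i.2%:R / (2 * L ^ 2)%N%:R in sqrtC (1 - y ^+ 2) + 'i * y.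

Definition gridpoint (i : gridindex) : vec :=
  \col_r if unlift 0 r is Some j then grid_tail i j
         else grid_phase i * grid_rho i.

Hypothesis L_gt0 : (0 < L)%N.

Lemma sqr_natrB_ge1 (F : numDomainType) (a b : nat) : a != b -> 1 <= (a%:R - b%:R) ^+ 2 :> F.
Proof.
wlog ab : a b / (b < a)%N => [H|_].
  by case: ltngtP => // ab _; [rewrite -sqrrN opprB|]; rewrite H // gtn_eqF.
by rewrite -natrB ?(ltnW ab) // exprn_ege1 // ler1n subn_gt0.
Qed.

Lemma sqr_norm_tail i j : 8%:R * n%:R * `|grid_tail i j| ^+ 2 <= 1.
Proof.
rewrite normf_div expr_div_n normr_nat normC2_rect ?realn //.
rewrite mulrA ler_pdivrMr; last by rewrite -natrX ltr0n expn_gt0 !muln_gt0 L_gt0.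
rewrite mul1r -!natrX -natrD -!natrM ler_nat.
have [a b] := (ltn_ord (i.1 j).1, ltn_ord (i.1 j).2).
have H1 : ((i.1 j).1 ^ 2 <= L ^ 2)%N by rewrite leq_exp2r // ltnW.
have H2 : ((i.1 j).2 ^ 2 <= L ^ 2)%N by rewrite leq_exp2r // ltnW.
apply: (@leq_trans (8 * n * (L ^ 2 + L ^ 2))).
  by rewrite leq_mul2l leq_add ?orbT.
have -> : (8 * n * (L ^ 2 + L ^ 2) = 16 * n * L ^ 2)%N by ring.
have nn : (n <= n.+1 ^ 2)%N by rewrite (leq_trans (leqnSn n)) // expnS expn1 leq_pmulr.
by rewrite !expnMn (_ : 4 ^ 2 = 16)%N // leq_mul2r leq_mul2l nn !orbT.
Qed.

Lemma sum_sqr_tail_le i : 8%:R * \sum_j `|grid_tail i j| ^+ 2 <= 1.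
Proof.
case: (posnP n) => [n0|n0].
  rewrite big1 ?mulr0 ?ler01 // => j _.
  by have := leq_trans (ltn_ord j) (eq_leq n0).
rewrite mulr_sumr -(@ler_pM2l _ n%:R) ?ltr0n // mulr_sumr mulr1.
apply: le_trans (ler_sum _ (fun j _ => _ : _ <= 1)) _ => [j _|].
  by rewrite mulrA [n%:R * _]mulrC; exact: sqr_norm_tail.
by rewrite sumr_const card_ord.
Qed.

Lemma sqr_grid_rho i : grid_rho i ^+ 2 = 1 - \sum_j `|grid_tail i j| ^+ 2.
Proof. by rewrite sqrtCK. Qed.

Lemma sqr_grid_rho_ge i : 3%:R <= 4%:R * grid_rho i ^+ 2.
Proof.
rewrite sqr_grid_rho mulrBr mulr1 lerBrDr addrC -lerBrDr -natrB //.
rewrite -(ler_pM2l (x := 2%:R)) ?ltr0n // mulrA -natrM mulr1.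
by apply: le_trans (sum_sqr_tail_le i) _; rewrite ler1n.
Qed.

Lemma grid_rho_real i : grid_rho i \is Num.real.
Proof.
apply: ger0_real; rewrite sqrtC_ge0 -sqr_grid_rho -(pmulr_rge0 _ (x := 4%:R)) ?ltr0n //.
exact: le_trans (ler0n _ _) (sqr_grid_rho_ge i).
Qed.

Definition grid_height (i : gridindex) : C := i.2%:R / (2 * L ^ 2)%N%:R.

Lemma grid_height_real i : grid_height i \is Num.real.
Proof. by rewrite rpred_div ?realn. Qed.

Lemma grid_height_lt1 i : 0 <= 1 - grid_height i ^+ 2.
Proof.
rewrite subr_ge0 exprn_ile1 // /grid_height ?divr_ge0 ?ler0n //.
rewrite ler_pdivrMr ?ltr0n ?muln_gt0 ?expn_gt0 ?L_gt0 // mul1r ler_nat.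
by rewrite (leq_trans (ltnW (ltn_ord i.2))) // leq_pmull.
Qed.

Lemma sqr_norm_phase i : `|grid_phase i| ^+ 2 = 1.
Proof.
rewrite normC2_rect ?grid_height_real ?sqrtCK ?subrK //.
by rewrite ger0_real // sqrtC_ge0 grid_height_lt1.
Qed.

Lemma gridpoint_sphere i : Bsphere (gridpoint i).
Proof.
rewrite /Bsphere /= hermE big_ord_recl !mxE unlift_none -normCK normrM exprMn.
rewrite sqr_norm_phase mul1r real_normK ?grid_rho_real // sqr_grid_rho.
rewrite -addrA -[RHS]addr0; congr (_ + _); rewrite addrC; apply/eqP; rewrite subr_eq0.
by apply/eqP; apply: eq_bigr => j _; rewrite !mxE liftK normCK.
Qed.

Lemma ler_sqr_norm_sub (a b : C) : `|a - b| ^+ 2 <= 2%:R * `|a| ^+ 2 + 2%:R * `|b| ^+ 2.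
Proof.
rewrite -subr_ge0 (_ : _ - _ = `|a + b| ^+ 2) ?exprn_ge0 //.
by rewrite !normCK !rmorphD !rmorphN /=; ring.
Qed.

(** 2 Re (1 - <x, y>) exceeds |x - y|^2 by (1 - |x|^2) + (1 - |y|^2). *)
Lemma sqr_dist_le (x y : vec) : herm x x <= 1 -> herm y y <= 1 ->
  herm (x - y) (x - y) <= 2%:R * `|1 - herm x y|.
Proof.
move=> x1 y1; apply: le_trans (_ : 2%:R * 'Re (1 - herm x y) <= _).
  rewrite !hermE2 (hermC y) ReE rmorphB rmorph1 -subr_ge0.
  rewrite (_ : _ - _ = (1 - herm x x) + (1 - herm y y)); last by field.
  by rewrite addr_ge0 ?subr_ge0.
by rewrite ler_pM2l ?ltr0n // leif_Re_Creal.
Qed.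

(** Euclidean distance, of order M^(-1/2), separates the tails. Once these agree, the Hermitian
    products with v differ only through the phases, and comparing them directly gives the finer
    scale 1 / M. *)
Lemma gridpoint_separated (i i' : gridindex) (v : vec) :
  let M := (128 * (n.+1 * L) ^ 2)%N%:R in
  Bsphere v ->
  `|1 - herm v (gridpoint i)| * M < 1 ->
  `|1 - herm v (gridpoint i')| * M < 1 -> i = i'.
Proof.
move=> M vS c1 c2.
have M0 : 0 < M by rewrite ltr0n muln_gt0 expn_gt0 muln_gt0 L_gt0.
have h i0 : `|1 - herm v (gridpoint i0)| * M < 1 ->
    herm (v - gridpoint i0) (v - gridpoint i0) * M < 2%:R.
  move=> H; apply: le_lt_trans (_ : 2%:R * `|1 - herm v (gridpoint i0)| * M < _).
    by rewrite ler_pM2r // sqr_dist_le ?vS // gridpoint_sphere.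
  by rewrite -mulrA -[ltRHS]mulr1 ltr_pM2l ?ltr0n.
have h1 := h _ c1; have h2 := h _ c2.
have close r : `|gridpoint i r 0 - gridpoint i' r 0| ^+ 2 * M < 8%:R.
  have -> : gridpoint i r 0 - gridpoint i' r 0 =
     (v - gridpoint i') r 0 - (v - gridpoint i) r 0 by rewrite !mxE; ring.
  apply: le_lt_trans (_ : (2%:R * herm (v - gridpoint i') (v - gridpoint i')
      + 2%:R * herm (v - gridpoint i) (v - gridpoint i)) * M < _).
    rewrite ler_pM2r //; apply: le_trans (ler_sqr_norm_sub _ _) _.
    by apply: lerD; rewrite ler_pM2l ?ltr0n // sqr_entry_le_herm.
  move: (herm _ _) (herm _ _) h2 h1 => x y xM yM.
  rewrite mulrDl -!mulrA -mulrDr (_ : 8%:R = 2%:R * (2%:R + 2%:R)); last by rewrite -natrD -natrM.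
  by rewrite ltr_pM2l ?ltr0n // ltrD.
(* This fixes the constant 128 = 8 * 4^2: coordinates differ in square by less than 8 / M, the
   squared mesh of the tails. *)
have MD : M = 8%:R * ((4 * n.+1 * L)%N%:R) ^+ 2.
  by rewrite /M -!natrX -!natrM; congr (_%:R); ring.
have D0 : ((4 * n.+1 * L)%N%:R : C) != 0.
  by rewrite pnatr_eq0 -lt0n !muln_gt0 L_gt0.
have eq1 : i.1 = i'.1.
  apply/ffunP => j; apply/eqP; apply: contraT => ne.
  suff /lt_geF : `|gridpoint i (lift 0 j) 0 - gridpoint i' (lift 0 j) 0| ^+ 2 * M < 8%:R.
    rewrite !mxE !liftK /grid_tail -mulrBl normf_div expr_div_n normr_nat MD.
    rewrite mulrCA mulfVK ?expf_neq0 // -[X in X <= _]mulr1 ler_pM2l ?ltr0n //.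
    rewrite opprD addrACA -mulrBr normC2_rect ?rpredB ?realn //.
    case/idP; case: (i.1 j) (i'.1 j) ne => a b [a' b']; rewrite xpair_eqE negb_and.
    case/orP => ne.
      rewrite -[X in X <= _]addr0 lerD ?sqr_natrB_ge1 // -realEsqr rpredB ?realn //.
    rewrite -[X in X <= _]add0r lerD ?sqr_natrB_ge1 // -realEsqr rpredB ?realn //.
  exact: close.
have rhoE : grid_rho i' = grid_rho i.
  by rewrite /grid_rho /grid_tail eq1.
suff : i.2 = i'.2 by case: (i) (i') eq1 => [? ?] [? ?] /= -> ->.
apply/eqP; apply: contraT => ne.
have M128 : 128%:R <= M by rewrite ler_nat leq_pmulr // expn_gt0 muln_gt0 L_gt0.
have rho2 : `|grid_rho i| ^+ 2 = grid_rho i ^+ 2 by rewrite real_normK ?grid_rho_real.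
(* v is close to a grid point whose first coordinate has squared modulus at least 3/4. *)
have v0 : 1 <= 4%:R * `|v 0 0| ^+ 2.
  have H : `|grid_rho i| ^+ 2 <= 2%:R * `|v 0 0| ^+ 2 +
      2%:R * herm (v - gridpoint i) (v - gridpoint i).
    have -> : `|grid_rho i| ^+ 2 = `|v 0 0 - (v - gridpoint i) 0 0| ^+ 2.
      rewrite !mxE unlift_none opprB addrC subrK normrM exprMn.
      by rewrite sqr_norm_phase mul1r.
    apply: le_trans (ler_sqr_norm_sub _ _) _; rewrite lerD2l ler_pM2l ?ltr0n //.
    exact: sqr_entry_le_herm.
  have H' : herm (v - gridpoint i) (v - gridpoint i) * 128%:R <= 2%:R.
    apply: le_trans (ltW h1); apply: ler_wpM2l => //; exact: herm_ge0.
  move: (sqr_grid_rho_ge i); rewrite -rho2 => H3.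
  rewrite -(ler_pM2l (x := 32%:R)) ?ltr0n //.
  have : 3%:R * 16%:R <= 4%:R * (2%:R * `|v 0 0| ^+ 2 +
      2%:R * herm (v - gridpoint i) (v - gridpoint i)) * 16%:R :> C.
    rewrite ler_pM2r ?ltr0n //; apply: le_trans H3 _.
    by rewrite ler_pM2l ?ltr0n.
  have -> : 4%:R * (2%:R * `|v 0 0| ^+ 2 +
      2%:R * herm (v - gridpoint i) (v - gridpoint i)) * 16%:R
     = 32%:R * (4%:R * `|v 0 0| ^+ 2) + herm (v - gridpoint i) (v - gridpoint i) * 128%:R.
    by ring.
  move=> H4; have {H4} := le_trans H4 (lerD (lexx _) H').
  rewrite -lerBlDr -natrM -natrB // mulr1; apply: le_trans; by rewrite ler_nat.
have phase : 1 <= (4 * L ^ 4)%N%:R * `|grid_phase i - grid_phase i'| ^+ 2.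
  have -> : grid_phase i - grid_phase i' =
     (sqrtC (1 - grid_height i ^+ 2) - sqrtC (1 - grid_height i' ^+ 2)) +
     'i * (grid_height i - grid_height i') by rewrite /grid_phase -!/(grid_height _); ring.
  rewrite normC2_rect ?rpredB ?grid_height_real //; last 2 first.
    by rewrite ger0_real // sqrtC_ge0 grid_height_lt1.
    by rewrite ger0_real // sqrtC_ge0 grid_height_lt1.
  apply: (@le_trans _ _ ((4 * L ^ 4)%N%:R * (grid_height i - grid_height i') ^+ 2)).
    rewrite /grid_height -mulrBl expr_div_n mulrCA -natrX.
    rewrite (_ : (4 * L ^ 4)%N = ((2 * L ^ 2) ^ 2)%N); last by ring.
    rewrite mulfV ?mulr1 ?sqr_natrB_ge1 // pnatr_eq0 -lt0n expn_gt0 muln_gt0.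
    by rewrite expn_gt0 L_gt0.
  rewrite ler_wpM2l ?ler0n // lerDr -realEsqr rpredB // ger0_real //;
    by rewrite sqrtC_ge0 grid_height_lt1.
have hd : herm v (gridpoint i) - herm v (gridpoint i') =
    v 0 0 * ((grid_phase i - grid_phase i') * grid_rho i)^*.
  rewrite !hermE !big_ord_recl opprD addrACA -sumrB big1 => [|j _].
    by rewrite addr0 !mxE unlift_none rhoE -mulrBr -rmorphB -mulrBl.
  by rewrite !mxE !liftK /grid_tail eq1 subrr.
pose q := `|herm v (gridpoint i) - herm v (gridpoint i')|.
have qM : q * M < 2%:R.
  rewrite /q (_ : _ - _ = (1 - herm v (gridpoint i')) - (1 - herm v (gridpoint i))); last by ring.
  apply: le_lt_trans (ler_wpM2r (ltW M0) (ler_normB _ _)) _.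
  by rewrite mulrDl; apply: lt_le_trans (ltrD c2 c1) _; rewrite -mulr2n.
have q2 : q ^+ 2 = `|v 0 0| ^+ 2 * `|grid_phase i - grid_phase i'| ^+ 2 * grid_rho i ^+ 2.
  by rewrite /q hd normrM norm_conjC normrM !exprMn rho2 mulrA.
have q0 : 0 <= q by rewrite normr_ge0.
have qL : q * (64 * L ^ 2)%N%:R < 1.
  rewrite -(ltr_pM2l (x := 2%:R)) ?ltr0n // mulr1; apply: le_lt_trans qM.
  rewrite mulrCA ler_wpM2l // -natrM ler_nat mulnA leq_mul2l /=.
  by rewrite expnMn leq_pmull ?orbT // expn_gt0.
have qlt : q ^+ 2 * (64 * L ^ 4)%N%:R < 1.
  apply: le_lt_trans (_ : (q * (64 * L ^ 2)%N%:R) ^+ 2 < 1); last first.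
    by rewrite exprn_ilt1 // mulr_ge0 ?ler0n.
  rewrite exprMn -natrX ler_wpM2l ?exprn_ge0 // ler_nat expnMn -expnM.
  by rewrite leq_mul2r orbC.
(* The moduli of v_0 and rho are at least 1/2 and the phases differ by at least 1 / (2 L^2), so q >=
   1 / (8 L^2). *)
suff : 1 <= q ^+ 2 * (64 * L ^ 4)%N%:R by rewrite (lt_geF qlt).
have r1 : 1 <= 4%:R * grid_rho i ^+ 2 by apply: le_trans (sqr_grid_rho_ge i); rewrite ler1n.
have -> : q ^+ 2 * (64 * L ^ 4)%N%:R = (4%:R * `|v 0 0| ^+ 2) *
   ((4 * L ^ 4)%N%:R * `|grid_phase i - grid_phase i'| ^+ 2) * (4%:R * grid_rho i ^+ 2).
  by rewrite q2 !natrM; ring.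
by apply: mulr_ege1 => //; exact: mulr_ege1.
Qed.

End Grid.

(** * Caps of the sphere and their measure *)

Section Caps.
Variables (R : realType) (n : nat).
Local Notation C := (Cplx R).
Local Notation vec := 'cV[C]_n.+1.
Local Notation e0 := (basept R n).

Lemma herm_continuousl (p : vec) : continuous (fun v : vec => herm v p).
Proof.
rewrite (_ : (fun _ => _) = fun v : vec => \sum_i v i 0 * (p i 0)^*); last first.
  by apply/funext => w; rewrite hermE.
apply: continuous_big => [|i _ v]; first exact: add_continuous.
have H := @coord_continuous C n.+1 1 i 0 v.
exact: (cvgM H (cvg_cst _)).
Qed.

Lemma herm_diag_continuous : continuous (fun v : vec => herm v v).
Proof.
rewrite (_ : (fun _ => _) = fun v : vec => \sum_i `|v i 0| * `|v i 0|); last first.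
  by apply/funext => w; rewrite hermE; apply: eq_bigr => i _; rewrite -normCK expr2.
apply: continuous_big => [|i _ v]; first exact: add_continuous.
have H := cvg_norm (@coord_continuous C n.+1 1 i 0 v).
exact: (cvgM (H _) (H _)).
Qed.

Lemma open_measurable_vec (A : set vec) : open A -> measurable (A : set (borel_vec R n)).
Proof. by move=> oA; apply: sub_sigma_algebra. Qed.

Lemma measurable_sphere : measurable (@Bsphere R n.+1 : set (borel_vec R n)).
Proof.
rewrite -[X in measurable X]setCK; apply: measurableC; apply: open_measurable_vec.
have cS : closed (@Bsphere R n.+1).
  apply: (@closed_comp _ _ (fun v : vec => herm v v) [set 1 : C]).
    by move=> x _; exact: herm_diag_continuous.
  exact/accessible_closed_set1/hausdorff_accessible/norm_hausdorff.
by rewrite openC.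
Qed.

Lemma open_herm_lt (p : vec) (r : C) : open [set v : vec | `|1 - herm v p| < r].
Proof.
rewrite (_ : mkset _ = (fun v => herm v p) @^-1` (ball (1 : C) r)).
  by apply: open_comp => [v _|]; [exact: herm_continuousl | exact: ball_open].
by rewrite -ball_normE.
Qed.

Lemma open_herm_gt (p : vec) (r : C) : 0 < r -> open [set v : vec | r < `|1 - herm v p|].
Proof.
move=> r0.
rewrite (_ : mkset _ = (fun v => herm v p) @^-1` [set x : C | r < `|1 - x|]) //.
apply: open_comp => [v _|]; first exact: herm_continuousl.
rewrite openE => x /= rx; apply/nbhs_ballP; exists (`|1 - x| - r) => /=.
  by rewrite subr_gt0.
rewrite -ball_normE => y /= xy; rewrite ltrBrDl in xy.
rewrite -(ltrD2r `|x - y|); apply: lt_le_trans (_ : `|1 - x| <= _).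
  exact: xy.
rewrite (_ : 1 - x = (1 - y) - (x - y) :> C) ?ler_normB //.
by rewrite opprB addrCA addrA subrKC.
Qed.

(** The nonisotropic cap of radius 1 / M. The centre may also lie inside the ball, and M = 0 gives
    the whole sphere. *)
Definition cap (p : vec) (M : nat) : set vec :=
  [set v | Bsphere v /\ `|1 - herm v p| * M%:R < 1].

Lemma measurable_cap p M : measurable (cap p M : set (borel_vec R n)).
Proof.
have [->|M0] := posnP M.
  rewrite (_ : cap p 0 = @Bsphere R n.+1); first exact: measurable_sphere.
  by apply/seteqP; split => v /=; [case|move=> vS; split; rewrite // mulr0 ltr01].
have E (x : C) : (x * M%:R < 1) = (x < M%:R^-1).
  by rewrite -[M%:R^-1]mul1r ltr_pdivlMr ?ltr0n.
rewrite (_ : cap p M = @Bsphere R n.+1 `&` [set v : vec | `|1 - herm v p| < M%:R^-1]).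
  by apply: measurableI; [exact: measurable_sphere|apply: open_measurable_vec; exact: open_herm_lt].
by apply/seteqP; split => v [vS H]; split => //; [rewrite /= -E | rewrite E].
Qed.

Variable vol : vec -> probability (borel_vec R n) R.
Hypothesis (n_gt0 : (1 <= n)%N) (volP : is_volM vol).

Lemma Bball0 : Bball (0 : vec).
Proof. by rewrite /Bball /= herm0l ltr01. Qed.

Lemma act_sphere (g : 'M[C]_(n.+1 + 1)) (v : vec) :
  Jisometry g -> Bsphere v -> Bsphere (Defs.act g v).
Proof.
rewrite /Bsphere /= => gJ vS; have vl : herm v v <= 1 by rewrite vS.
have := herm_act gJ vl vl; rewrite vS subrr => /eqP.
rewrite !mulf_eq0 conjC_eq0 (negbTE (lastc_homog_neq0 gJ vl)) /= subr_eq0.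
by move=> /eqP <-.
Qed.

(** An element of SU fixing the origin has denominators of modulus 1, hence preserves |1 - <v, p>|
    on the sphere as well as [vol 0]. *)
Lemma cap_rotate p M : Bsphere p -> vol 0 (cap p M) = vol 0 (cap e0 M).
Proof.
move=> pS; have [g [gSU g0 ge]] := SU_transitive n_gt0 Bball0 pS.
have [gJ _] := gSU; have o1 : herm (0 : vec) 0 <= 1 by rewrite herm0l ler01.
rewrite -{1}g0 (volP.2 _ _ _ gSU Bball0 (measurable_cap p M)); congr (vol 0 _).
have e1 : herm e0 e0 <= 1 by rewrite herm_basept.
have d1 : `|lastc (g *m homog 0)| = 1.
  apply/eqP; rewrite -(@eqrXn2 _ 2) ?normr_ge0 ?ler01 // expr1n normCK.
  by have := sqr_lastc_origin gJ; rewrite g0 herm0l subr0 mulr1 => ->.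
have dist v : herm v v = 1 -> `|1 - herm (Defs.act g v) p| = `|1 - herm v e0|.
  move=> v1; have vl : herm v v <= 1 by rewrite v1.
  have c1 x : herm x x <= 1 -> `|lastc (g *m homog x)| = 1.
    move=> x1; have /(congr1 Num.norm) := herm_act gJ x1 o1.
    by rewrite g0 !herm0r subr0 mulr1 normrM norm_conjC d1 mulr1 normr1.
  have /(congr1 Num.norm) := herm_act gJ vl e1.
  by rewrite !normrM norm_conjC !c1 // !mul1r ge.
apply/seteqP; split => v /=.
  by move=> [vS [_ H]]; split => //; rewrite -dist.
move=> [vS H]; split => //; split; last by rewrite dist.
exact: act_sphere.
Qed.

Lemma cap_measure_le p L : (0 < L)%N -> Bsphere p ->
  (vol 0 (cap p (128 * (n.+1 * L) ^ 2)) * (L ^ (2 * n.+1))%N%:R%:E <= 1)%E.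
Proof.
move=> L0 pS; set M := (128 * _)%N.
pose I := gridindex n L; pose A (i : I) : set (borel_vec R n) := cap (gridpoint R i) M.
have mA i : measurable (A i) by exact: measurable_cap.
have tA : trivIset setT A.
  move=> i i' _ _ [v [[vS c1] [_ c2]]]; exact: (gridpoint_separated L0 vS c1 c2).
have <- : (\sum_(i : I) vol 0 (A i) = vol 0 (cap p M) * (L ^ (2 * n.+1))%N%:R%:E)%E.
  (* L^(2n) tails times L^2 phases. *)
  have cI : #|I| = (L ^ (2 * n.+1))%N.
    rewrite card_prod card_ffun card_prod !card_ord mulnn -expnM -expnD.
    by congr (_ ^ _)%N; ring.
  rewrite -cI.
  under eq_bigr => i _ do
    rewrite /A (cap_rotate _ (gridpoint_sphere R L0 i)) -(cap_rotate M pS).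
  have -> : vol 0 (cap p M) = (fine (vol 0 (cap p M)))%:E.
    by rewrite fineK // fin_num_measure //; exact: measurable_cap.
  by rewrite sumEFin sumr_const -EFinM mulr_natr.
have -> : (\sum_(i : I) vol 0 (A i) = vol 0 (\bigcup_(i in [set` index_enum I]) A i))%E.
  rewrite measure_fin_bigcup //; last exact: sub_trivIset tA.
  by rewrite fsbig_seq // index_enum_uniq.
apply: probability_le1; apply: fin_bigcup_measurable => //.
Qed.

End Caps.

(** * Superlevel sets of the aperture *)

Section Aperture.
Variables (R : realType) (n : nat).
Local Notation C := (Cplx R).
Local Notation vec := 'cV[C]_n.+1.
Variable vol : vec -> probability (borel_vec R n) R.
Hypothesis (n_gt0 : (1 <= n)%N) (volP : is_volM vol).

(** Here a = g^-1 0. The last coordinate of g v is minus its pairing with [homog 0]; transporting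
    this pairing by g^-1 produces 1 - <v, a>. Large aperture thus becomes closeness to a. *)
Lemma aperture_act g : Jisometry g ->
  exists2 a : vec, Bball a & forall v, Bsphere v ->
    0 < `|1 - herm v a| /\
    aperture (Defs.act g 0) (Defs.act g v) = `|1 - herm v a|^-1.
Proof.
move=> gJ; have gV := Jisometry_inv gJ.
have o1 : herm (0 : vec) 0 <= 1 by rewrite herm0l ler01.
exists (Defs.act (invmx g) 0).
  have /eqP := sqr_lastc_origin gV; set e := lastc _ => e1.
  rewrite /Bball /= -subr_gt0.
  have e0 : 0 < e * e^*.
    by rewrite -normCK exprn_gt0 // normr_gt0; exact: lastc_homog_neq0.
  by rewrite -(pmulr_rgt0 _ e0) (eqP e1) ltr01.
set a := Defs.act (invmx g) 0.
have cE x : lastc (g *m homog x) = (lastc (invmx g *m homog 0))^* * (1 - herm x a).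
  have <- : - jform (g *m homog x) (homog 0) = lastc (g *m homog x).
    by rewrite jformE /homog col_mxKu herm0r -/(homog _) lastc_homog rmorph1 mulr1 sub0r opprK.
  rewrite -(jform_isometry _ _ gV) mulKmx ?Jisometry_unit // (homog_act gV o1).
  by rewrite jformZr jform_homog -mulrN opprB -/a -homog_act.
move=> v vS; have v1 : herm v v <= 1 by rewrite vS.
have d0 := lastc_homog_neq0 gJ o1; have c0 := lastc_homog_neq0 gJ v1.
have dE : lastc (g *m homog 0) = (lastc (invmx g *m homog 0))^*.
  by rewrite cE herm0l subr0 mulr1.
have := sqr_lastc_origin gJ; have := herm_act gJ v1 o1; rewrite herm0r subr0.
move: (cE v); rewrite -dE.
move: (lastc (g *m homog v)) (lastc (g *m homog 0)) c0 d0 => c d c0 d0 cd.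
move=> /(congr1 Num.norm); rewrite !normrM norm_conjC normr1 => H1 H2.
rewrite /aperture; move: H1 H2; set N := `|_ - _|; set D := 1 - _ => H1 H2.
have nc0 : `|c| != 0 by rewrite normr_eq0.
have nd0 : `|d| != 0 by rewrite normr_eq0.
have -> : N = (`|c| * `|d|)^-1.
  by apply: (mulfI (mulf_neq0 nc0 nd0)); rewrite H1 mulfV // mulf_neq0.
have -> : D = (`|d| ^+ 2)^-1.
  by apply: (mulfI (expf_neq0 2 nd0)); rewrite normCK H2 mulfV // -normCK expf_neq0.
have -> : 1 - herm v a = c / d by rewrite cd mulrC mulKf.
split; first by rewrite normf_div divr_gt0 ?normr_gt0.
by rewrite normf_div; field; rewrite nc0 nd0.
Qed.

(** Push the centre radially to p = a / |a|. With t = |a| and h = <v, p>, both terms of 1 - h = (1 -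
    th) - (1 - t)h are at most |1 - th|, which doubles the radius. For a = 0 the cap is empty. *)
Lemma cap_interior_sub (a : vec) M : Bball a -> (0 < M)%N ->
  exists2 p, Bsphere p & cap a (2 * M) `<=` cap p M.
Proof.
rewrite /Bball /= => a1 M0; have [->|a0] := eqVneq a 0.
  exists (basept R n); first exact: herm_basept.
  move=> v [_]; rewrite herm0r subr0 normr1 mul1r ltrn1.
  by move: M0; case: (M).
pose t := sqrtC (herm a a).
have t0 : 0 < t by rewrite sqrtC_gt0 lt_def herm_ge0 herm_eq0 a0.
have tt : t ^+ 2 = herm a a by rewrite sqrtCK.
have t1 : t < 1 by rewrite -(@expr_lt1 _ 2) ?ltW // tt.
have tC : t^* = t by apply: CrealP; rewrite gtr0_real.
have t0' : t != 0 by rewrite gt_eqF.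
pose p := t^-1 *: a.
have pS : Bsphere p.
  by rewrite /Bsphere /= /p hermZl hermZr fmorphV /= tC -tt; field.
exists p => // v [vS H]; split => //=.
apply: le_lt_trans H; rewrite natrM mulrA ler_pM2r ?ltr0n //.
have aE : herm v a = t * herm v p.
  by rewrite /p hermZr fmorphV /= tC mulrA mulfV // mul1r.
have h1 : `|herm v p| <= 1.
  rewrite -(@expr_le1 _ 2) //; apply: le_trans (CauchySchwarz_herm v p) _.
  by rewrite vS pS mulr1.
rewrite aE; move: (herm v p) h1 => h h1.
have th : t * `|h| <= t by rewrite ler_piMr // ltW.
have n1 : 1 - t <= `|1 - t * h|.
  apply: le_trans (_ : 1 - t * `|h| <= _); first by rewrite lerD2l lerN2.
  have := lerB_dist 1 (t * h); rewrite normr1 normrM (gtr0_norm t0) //.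
rewrite (_ : 1 - h = (1 - t * h) - (1 - t) * h); last by ring.
apply: le_trans (ler_normB _ _) _; rewrite mulr_natr mulr2n lerD2l.
rewrite normrM gtr0_norm ?subr_gt0 //; apply: le_trans n1.
by rewrite ler_piMr // subr_ge0 ltW.
Qed.

Definition wide (z : vec) (M : nat) : set vec :=
  [set u | Bsphere u /\ (2 * M)%N%:R < aperture z u].

Lemma measurable_wide z M : Bball z -> (0 < M)%N ->
  measurable (wide z M : set (borel_vec R n)).
Proof.
rewrite /Bball /= -subr_gt0 => z1 M0.
have r0 : 0 < (2 * M)%N%:R * (1 - herm z z) by rewrite mulr_gt0 // ltr0n muln_gt0.
rewrite (_ : wide z M = @Bsphere R n.+1 `&`
    [set u : vec | (2 * M)%N%:R * (1 - herm z z) < `|1 - herm u z|]).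
  by apply: measurableI; [exact: measurable_sphere|
    apply: open_measurable_vec; exact: open_herm_gt].
by apply/seteqP; split => v [vS H]; split => //; move: H; rewrite /= ltr_pdivlMr.
Qed.

Lemma wide_measure_le z L : Bball z -> (0 < L)%N ->
  (vol z (wide z (128 * (n.+1 * L) ^ 2)) <= ((L ^ (2 * n.+1))%N%:R^-1)%:E)%E.
Proof.
move=> zB L0; set M := (128 * _)%N.
have M0 : (0 < M)%N by rewrite muln_gt0 expn_gt0 muln_gt0 L0.
have [g [gSU gz _]] := SU_transitive n_gt0 zB (herm_basept R n).
have [gJ _] := gSU; have [a aB aE] := aperture_act gJ.
have [p pS ap] := cap_interior_sub aB M0.
have -> : (vol z (wide z M) = vol 0 (cap a (2 * M)))%E.
  rewrite -{1}gz (volP.2 _ _ _ gSU (Bball0 R n) (measurable_wide zB M0)).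
  have E v : Bsphere v ->
      ((2 * M)%N%:R < aperture z (Defs.act g v)) = (`|1 - herm v a| * (2 * M)%N%:R < 1).
    move=> vS; have [N0] := aE v vS; rewrite gz => ->.
    by rewrite -[X in _ < X]mul1r ltr_pdivlMr // mulrC.
  congr (vol 0 _); apply/seteqP; split => v.
    by move=> [vS [_ H]]; split => //; rewrite -E.
  by move=> [vS H]; split => //; split; [exact: act_sphere | rewrite E].
apply: (@le_trans _ _ (vol 0 (cap p M))).
  by apply: le_measure => //; rewrite inE; exact: measurable_cap.
rewrite -[leRHS]mul1e lee_pdivlMr ?ltr0n ?expn_gt0 ?L0 //.
exact: cap_measure_le.
Qed.

End Aperture.

(** * Integral estimates *)

Section IntegralBound.
Local Open Scope ereal_scope.
Variables (d : measure_display) (T : measurableType d) (R : realType).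

(* Holds without measurability, since the integral of a nonnegative function
   is a supremum of integrals of simple functions below it. *)
Lemma ge0_le_integral_nonmeasurable (mu : {measure set T -> \bar R}) (D : set T)
    (f g : T -> \bar R) :
  (forall x, D x -> 0 <= f x) -> (forall x, D x -> f x <= g x) ->
  \int[mu]_(x in D) f x <= \int[mu]_(x in D) g x.
Proof.
move=> f0 fg; rewrite !ge0_integralE //; last first.
  by move=> x Dx; exact: le_trans (f0 x Dx) (fg x Dx).
apply: ge_ereal_sup => _ /= [h hf <-]; apply: ereal_sup_ubound; exists h => // x.
apply: le_trans (hf x) _; rewrite !patchE; case: ifPn => // xD.
by apply: fg; rewrite inE in xD.
Qed.

Lemma integral_layers (mu : probability T R) (D : set T) (c0 : R) N
    (c m : nat -> R) (A : nat -> set T) :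
  measurable D -> (0 <= c0)%R -> (forall j, (0 <= c j)%R) ->
  (forall j, measurable (A j)) -> (forall j, mu (A j) <= (m j)%:E) ->
  \int[mu]_(x in D) (c0 + \sum_(j < N) c j * \1_(A j) x)%:E
    <= (c0 + \sum_(j < N) c j * m j)%:E.
Proof.
move=> mD c00 cj0 mA mAm.
under eq_integral do rewrite EFinD -sumEFin.
have mi j : measurable_fun D (EFin \o (fun x => c j * \1_(A j) x)%R).
  by apply/measurable_EFinP; apply: measurable_funM => //; exact: measurable_indic.
rewrite ge0_integralD //=; last 2 first.
- by move=> x _; apply: sume_ge0 => j _ /=; rewrite lee_fin mulr_ge0.
- by apply: emeasurable_sum => j _; exact: mi.
rewrite integral_cst // EFinD leeD //.
  by rewrite -[leRHS]mule1 lee_wpmul2l ?lee_fin // probability_le1.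
rewrite ge0_integral_sum //; last 2 first.
- by move=> j; exact: mi.
- by move=> j x _; rewrite lee_fin mulr_ge0.
rewrite -sumEFin; apply: lee_sum => j _.
under eq_integral do rewrite EFinM.
rewrite ge0_integralZl_EFin //; last first.
  by apply/measurable_EFinP; exact: measurable_indic.
rewrite integral_indic // EFinM lee_wpmul2l ?lee_fin //.
by apply: le_trans (mAm j); apply: le_measure; rewrite ?inE //; exact: measurableI.
Qed.

(** f is not assumed measurable: its positive and negative parts are compared separately with the
    layered majorant, and the difference of two numbers in [0, b] has modulus at most b. *)
Lemma Rintegral_layers (mu : probability T R) (D : set T) (f : T -> R) (c0 : R) N
    (c m : nat -> R) (A : nat -> set T) :
  measurable D -> (0 <= c0)%R -> (forall j, (0 <= c j)%R) ->
  (forall j, measurable (A j)) -> (forall j, mu (A j) <= (m j)%:E) ->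
  (forall x, D x -> `|f x| <= c0 + \sum_(j < N) c j * \1_(A j) x)%R ->
  (`|Rintegral mu D f| <= c0 + \sum_(j < N) c j * m j)%R.
Proof.
move=> mD c00 cj0 mA mAm fg.
have G := integral_layers N mD c00 cj0 mA mAm.
have Ip : \int[mu]_(x in D) ((EFin \o f)^\+ x) <= (c0 + \sum_(j < N) c j * m j)%:E.
  apply: le_trans G; apply: ge0_le_integral_nonmeasurable => x Dx.
    exact: funepos_ge0.
  by rewrite funeposE /= -EFin_max lee_fin ge_max (le_trans (ler_norm _) (fg x Dx))
    (le_trans (normr_ge0 _) (fg x Dx)).
have In : \int[mu]_(x in D) ((EFin \o f)^\- x) <= (c0 + \sum_(j < N) c j * m j)%:E.
  apply: le_trans G; apply: ge0_le_integral_nonmeasurable => x Dx.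
    exact: funeneg_ge0.
  rewrite funenegE /= -EFin_max lee_fin ge_max (le_trans (normr_ge0 _) (fg x Dx)) andbT.
  by rewrite (le_trans _ (fg x Dx)) // -normrN ler_norm.
rewrite /Rintegral integralE.
have Ip0 : 0 <= \int[mu]_(x in D) ((EFin \o f)^\+ x).
  by apply: integral_ge0 => x _; exact: funepos_ge0.
have In0 : 0 <= \int[mu]_(x in D) ((EFin \o f)^\- x).
  by apply: integral_ge0 => x _; exact: funeneg_ge0.
move: Ip0 In0 Ip In; rewrite -/(EFin \o f).
move: (\int[mu]_(x in D) _) (\int[mu]_(x in D) _) => [a||] [b||] //=.
rewrite !lee_fin => a0 b0 aB bB; rewrite ler_norml; apply/andP; split; lra.
Qed.

End IntegralBound.

(** * Summation over dyadic layers *)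

Section PoissonBound.
Variables (R : realType) (n k : nat).
Local Notation C := (Cplx R).
Local Notation vec := 'cV[C]_n.+1.
Variable vol : vec -> probability (borel_vec R n) R.
Hypothesis (n_gt0 : (1 <= n)%N) (volP : is_volM vol) (k_le : (k <= n)%N).

(** The threshold to which [wide_measure_le] applies with L = 2^j. *)
Let thr j := (2 * (128 * (n.+1 * 2 ^ j) ^ 2))%N.
Let h : R := 2%:R^-1.
Let G : R := ((2 * thr 1) ^ k)%N%:R.

Lemma geometric_tail J N :
  \sum_(j < N) (J <= j)%:R * h ^+ j <= 2%:R * h ^+ J.
Proof.
(* The exact value of the truncated sum, which is 0 for N <= J; the induction runs on it. *)
apply: (@le_trans _ _ (2%:R * h ^+ J - 2%:R * h ^+ maxn N J)); last first.
  by rewrite gerBl mulr_ge0 // exprn_ge0 // invr_ge0.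
elim: N => [|N IH]; first by rewrite big_ord0 max0n subrr.
rewrite big_ord_recr /=; case: (leqP J N) => JN.
  rewrite (maxn_idPl (leq_trans JN (leqnSn N))).
  apply: le_trans (lerD IH (lexx _)) _; rewrite (maxn_idPl JN) mul1r exprS.
  by move: (h ^+ N) (h ^+ J) => x y; rewrite /h; lra.
by rewrite mul0r addr0 (maxn_idPr JN); move: IH; rewrite (maxn_idPr (ltnW JN)).
Qed.

Lemma thrS j : thr j.+1 = (4 ^ j * thr 1)%N.
Proof.
rewrite /thr (expnS 2 j) (_ : 4 ^ j = 2 ^ j * 2 ^ j)%N; last by rewrite -expnMn.
by move: (2 ^ j)%N => x; ring.
Qed.

(** The thresholds grow like 4^j and the masses decay like 4^(-j(n+1)); k <= n leaves a ratio of at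
    most 1/4, of which 1/2 is retained. *)
Lemma layer_mass j :
  ((2 * thr j.+1) ^ k)%N%:R * (((2 ^ j) ^ (2 * n.+1))%N%:R)^-1 <= G * h ^+ j.
Proof.
rewrite ler_pdivrMr ?ltr0n ?expn_gt0 // /h exprVn mulrAC ler_pdivlMr ?exprn_gt0 //.
rewrite /G -natrX -!natrM ler_nat thrS mulnCA expnMn mulnAC mulnC leq_mul2l.
apply/orP; right; rewrite -(_ : 2 ^ 2 = 4)%N // -!expnM -expnD leq_exp2l //.
have jk : (j * k <= j * n)%N by rewrite leq_mul2l k_le orbT.
rewrite (_ : j * (2 * n.+1) = 2 * (j * n) + 2 * j)%N; last by ring.
apply: leq_add; last by rewrite leq_pmull.
by rewrite leq_mul2l jk orbT.
Qed.

Lemma layer_exists (phi : R) N : phi <= (thr N)%:R ->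
  phi <= (thr 0)%:R \/
  exists j : 'I_N, (thr j)%:R < phi /\ phi <= (thr j.+1)%:R.
Proof.
elim: N => [|N IH] phiN; first by left.
have [phiN'|phiN'] := leP phi (thr N)%:R.
  case: (IH phiN') => [|[j jP]]; [by left|right].
  by exists (widen_ord (leqnSn N) j).
by right; exists ord_max.
Qed.

Lemma leq_thr i j : (i <= j)%N -> (thr i <= thr j)%N.
Proof.
move=> ij; rewrite /thr !leq_mul2l /= leq_exp2r // leq_mul2l leq_exp2l //=.
Qed.

Lemma aperture_real (z u : vec) : Bball z -> exists2 phi : R, 0 <= phi & aperture z u = toC phi.
Proof.
rewrite /Bball /= -subr_gt0 => z1; have F0 : 0 <= aperture z u.
  by rewrite divr_ge0 // ltW.
exists (complex.Re (aperture z u)); last by rewrite toC_Re // ger0_real.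
by rewrite -toC_ge0 toC_Re // ger0_real.
Qed.

(** For fixed z the aperture is at most 2 / (1 - |z|^2), so finitely many layers cover the sphere.
    Their number depends on z, the final bound does not. *)
Lemma aperture_bound (z : vec) : Bball z -> exists N, forall u, Bsphere u ->
  aperture z u <= (thr N)%:R.
Proof.
rewrite /Bball /= -subr_gt0 => z1.
have [N NP] : exists N : nat, 2%:R / (1 - herm z z) <= N%:R :> C.
  have F0 : 0 <= 2%:R / (1 - herm z z) by rewrite divr_ge0 // ltW.
  exists (Num.truncn (complex.Re (2%:R / (1 - herm z z)))).+1.
  rewrite -(toC_Re (ger0_real F0)) -toC_nat ler_toC ltW //.
  exact: truncnS_gt.
exists N => u uS; apply: (@le_trans _ _ N%:R); last first.
  rewrite ler_nat /thr; apply: leq_trans (ltnW (ltn_expl N (isT : 1 < 2)%N)) _.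
  apply: leq_trans (_ : (n.+1 * 2 ^ N) ^ 2 <= _)%N; last by rewrite mulnA leq_pmull.
  by rewrite expnMn -{1}(mul1n (2 ^ N)%N) leq_mul ?expn_gt0 // expnS leq_pmulr ?expn_gt0.
apply: le_trans NP; rewrite /aperture ler_pM2r ?invr_gt0 //.
apply: le_trans (ler_normB _ _) _; rewrite normr1 mulr2n lerD2l.
rewrite -(@expr_le1 _ 2) //; apply: le_trans (CauchySchwarz_herm u z) _.
by rewrite uS mul1r -subr_ge0 ltW.
Qed.

(** The factor 2 comes from treating real and imaginary parts separately. *)
Lemma Cintegral_layers (z : vec) (f : vec -> C) (A : nat -> set (borel_vec R n))
    (c0 : R) N (c m : nat -> R) :
  0 <= c0 -> (forall j, 0 <= c j) ->
  (forall j, measurable (A j)) -> (forall j, (vol z (A j) <= (m j)%:E)%E) ->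
  (forall u, Bsphere u -> `|f u| <= toC (c0 + \sum_(j < N) c j * \1_(A j) u)) ->
  `|Cintegral (vol z) (@Bsphere R n.+1) f|
    <= toC (2%:R * (c0 + \sum_(j < N) c j * m j)).
Proof.
move=> c00 cj mA mAm fb; apply: le_trans (norm_le_Re_Im _) _.
rewrite ler_toC mulr_natl mulr2n /=.
have mS := @measurable_sphere R n.
by apply: lerD; apply: (Rintegral_layers (A := A)) => // u uS;
  rewrite -ler_toC; apply: le_trans (fb u uS); [exact: norm_Re_le|exact: norm_Im_le].
Qed.

Lemma Poisson_bound (al : forms R n k) (z : vec) (e B : R) J (Xi : 'M[C]_(n.+1, k)) :
  Bball z -> 0 <= e -> 0 <= B ->
  (forall u r (Z : 'M[C]_(n.+1, k)), Bsphere u -> 0 <= r -> inH u Z ->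
    (forall j, herm (col j Z) (col j Z) <= r ^+ 2) ->
    `|al u Z| <= coeff_size al u * r ^+ k) ->
  (forall u, Bsphere u -> coeff_size al u <= toC B) ->
  (forall u, Bsphere u -> aperture z u <= (thr J)%:R -> coeff_size al u <= toC e) ->
  (forall j, bergman z (col j Xi) (col j Xi) <= (1 - herm z z)^-1) ->
  `|Poisson vol al z Xi| <= toC (2%:R * (G * (3%:R * e + 2%:R * (B * h ^+ J)))).
Proof.
move=> zB e0 B0 alZ alB ale XiB.
have [N NP] := aperture_bound zB.
(* [c0] serves F <= [thr 0], and [c j] the layer up to [thr j.+1]: there the coefficients are at
   most e if j < J, since then F <= [thr J], and at most B otherwise. *)
pose c0 : R := e * ((2 * thr 0) ^ k)%N%:R.
pose c j : R := (e + (J <= j)%:R * B) * ((2 * thr j.+1) ^ k)%N%:R.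
pose m j : R := (((2 ^ j) ^ (2 * n.+1))%N%:R)^-1.
pose A j : set (borel_vec R n) := wide z (128 * (n.+1 * 2 ^ j) ^ 2).
have eB j : 0 <= e + (J <= j)%:R * B by rewrite addr_ge0 // mulr_ge0.
have c00 : 0 <= c0 by rewrite mulr_ge0.
have cj j : 0 <= c j by rewrite mulr_ge0.
have mA j : measurable (A j).
  by apply: measurable_wide => //; rewrite muln_gt0 expn_gt0 muln_gt0 expn_gt0.
have mAm j : (vol z (A j) <= (m j)%:E)%E.
  by apply: wide_measure_le => //; rewrite expn_gt0.
rewrite /Poisson; apply: le_trans (Cintegral_layers (N := N) c00 cj mA mAm _) _.
  move=> u uS; have [Z [-> ZH Zr]] := kernel_form_bound al n_gt0 zB uS XiB.
  have [phi phi0 phiE] := aperture_real u zB.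
  have two : 2%:R * aperture z u = toC (2%:R * phi) by rewrite toCM toC_nat phiE.
  have r0 : 0 <= 2%:R * phi by rewrite mulr_ge0.
  have sum0 : 0 <= \sum_(j < N) c j * \1_(A j) u.
    by apply: sumr_ge0 => j _; rewrite mulr_ge0.
  have bound (b : R) M : 0 <= b -> coeff_size al u <= toC b -> phi <= M%:R ->
      `|al u Z| <= toC (b * ((2 * M) ^ k)%N%:R).
    move=> b0 ub phiM; rewrite two in Zr.
    apply: le_trans (alZ _ _ _ uS _ ZH Zr) _; first by rewrite toC_ge0.
    apply: (@le_trans _ _ (toC b * toC (2%:R * phi) ^+ k)).
      by rewrite ler_wpM2r // exprn_ge0 // toC_ge0.
    rewrite -toCX -toCM ler_toC ler_wpM2l // natrX natrM.
    by apply: lerXn2r; rewrite ?nnegrE ?mulr_ge0 // ler_wpM2l.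
  have phiN : phi <= (thr N)%:R.
    by rewrite -ler_toC toC_nat -phiE NP.
  have small M : (M <= thr J)%N -> phi <= M%:R -> coeff_size al u <= toC e.
    move=> MJ phiM; apply: ale => //; rewrite phiE -toC_nat ler_toC.
    by apply: le_trans phiM _; rewrite ler_nat.
  case: (layer_exists phiN) => [phi1|[j [phij phij1]]].
    apply: le_trans (bound e _ e0 (small _ (leq_thr (leq0n J)) phi1) phi1) _.
    by rewrite ler_toC lerDl.
  have uA : \1_(A j) u = 1 :> R.
    rewrite indicE mem_set //; split => //.
    by rewrite phiE -toC_nat ltr_toC.
  (* The sets [A i] are nested and u may lie in several, but the term of its own layer already
     suffices. *)
  apply: (@le_trans _ _ (toC (c j))); last first.
    rewrite ler_toC (bigD1 j) //= uA mulr1 addrCA lerDl addr_ge0 //.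
    by apply: sumr_ge0 => i _; rewrite mulr_ge0.
  apply: bound => //; have [Jj|jJ] := leqP J j.
    apply: le_trans (alB u uS) _; rewrite ler_toC mul1r lerDr //.
  by rewrite mul0r addr0; apply: small phij1; exact: leq_thr.
rewrite ler_toC ler_pM2l ?ltr0n //.
have G0 : 0 <= G by [].
have c0G : c0 <= G * e.
  rewrite mulrC ler_wpM2l // ler_nat; case: (k) => // k'.
  by rewrite leq_exp2r // leq_mul2l leq_thr.
have sG : \sum_(j < N) c j * m j <=
    G * (e * (\sum_(j < N) (0 <= j)%N%:R * h ^+ j) + B * (\sum_(j < N) (J <= j)%:R * h ^+ j)).
  rewrite !mulr_sumr -big_split mulr_sumr; apply: ler_sum => j _ /=.
  rewrite mul1r /c -mulrA; apply: le_trans (ler_wpM2l (eB j) (layer_mass j)) _.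
  by rewrite le_eqVlt; apply/orP; left; apply/eqP; ring.
apply: le_trans (lerD c0G sG) _; rewrite -mulrDr ler_wpM2l //.
have g0 := geometric_tail 0 N; have gJ := geometric_tail J N.
apply: (@le_trans _ _ (e + (e * (2%:R * h ^+ 0) + B * (2%:R * h ^+ J)))).
  by rewrite lerD2l lerD // ler_wpM2l.
by rewrite expr0 mulr1 le_eqVlt; apply/orP; left; apply/eqP; ring.
Qed.

End PoissonBound.

(** * The limit at the boundary *)

Section Boundary.
Variables (R : realType) (n : nat).
Local Notation C := (Cplx R).
Local Notation vec := 'cV[C]_n.+1.

Lemma cvg_right_of_within (a : R) (gam : R -> vec) : 0 < a ->
  {within `[0, a[%classic, continuous gam} -> gam @ (0 : R)^'+ --> gam 0.
Proof.
move=> a0 gc; have := gc 0; rewrite /continuous_at => H B /H.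
have I0 : `[0, a[%classic (0 : R) by rewrite /= in_itv /= lexx.
rewrite /nbhs /= -(nbhs_subspace_in I0) /within /= => HB.
near=> t; have tP : 0 < t < a.
  by apply/andP; split; [near: t; exact: nbhs_right_gt | near: t; exact: nbhs_right_lt].
suff : `[0, a[%classic t -> B (gam t).
  by apply; rewrite /= in_itv /=; case/andP: tP => /ltW -> ->.
near: t; exact: (cvg_within _ HB).
Unshelve. all: by end_near. Qed.

(** The aperture bound gives |v - z|^2 <= 2 J (1 - |z|^2), and both 1 - |z|^2 and |z - u| tend to 0
    as z approaches the sphere at u. *)
Lemma narrow_near (u : vec) (J : nat) (d : R) : Bsphere u -> 0 < d ->
  \forall z \near u, Bball z -> forall v, Bsphere v ->
    aperture z v <= J%:R -> herm (v - u) (v - u) < toC d.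
Proof.
move=> uS d0.
pose f (z : vec) : C := 4%:R * J%:R * (1 - herm z z) + 2%:R * herm (z - u) (z - u).
have fc : f @ u --> f u.
  have H1 := @herm_diag_continuous R n u.
  have H2 : (fun z : vec => herm (z - u) (z - u)) @ u --> herm (u - u) (u - u).
    apply: (@continuous_comp _ _ _ (fun z : vec => z - u) (fun z : vec => herm z z)).
      have I : (fun z : vec => z) @ u --> u by exact: cvg_id.
      exact: (cvgB I (cvg_cst u)).
    exact: herm_diag_continuous.
  exact: (cvgD (cvgM (cvg_cst _) (cvgB (cvg_cst _) H1)) (cvgM (cvg_cst _) H2)).
have fu : f u = 0 by rewrite /f uS !subrr herm0l !mulr0 addr0.
have d0' : 0 < toC d by rewrite -[0]/(toC 0) ltr_toC.
have /cvgrPdist_lt /(_ _ d0') := fc; rewrite fu.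
apply: filterS => z; rewrite sub0r normrN => fz zB v vS ap.
have z1 : 0 < 1 - herm z z by rewrite subr_gt0.
have f0 : 0 <= f z.
  by rewrite addr_ge0 // mulr_ge0 ?herm_ge0 ?(ltW z1) // mulr_ge0.
rewrite ger0_norm // in fz; apply: le_lt_trans fz.
have -> : v - u = (v - z) - (u - z) by rewrite opprB addrA subrK.
have E : herm (v - z) (v - z) <= 2%:R * (J%:R * (1 - herm z z)).
  have v1 : herm v v <= 1 by rewrite vS.
  apply: le_trans (sqr_dist_le v1 (ltW zB)) _.
  by rewrite ler_pM2l ?ltr0n // -ler_pdivrMr.
have par (x y : vec) : herm (x - y) (x - y) <= 2%:R * herm x x + 2%:R * herm y y.
  rewrite -subr_ge0 (_ : _ - _ = herm (x + y) (x + y)) ?herm_ge0 //.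
  by rewrite !hermE2; ring.
apply: le_trans (par _ _) _; rewrite /f; apply: lerD.
  apply: le_trans (_ : 2%:R * (2%:R * (J%:R * (1 - herm z z))) <= _).
    by rewrite ler_pM2l ?ltr0n.
  by rewrite !mulrA -natrM.
by rewrite -(opprB z u) hermNl hermNr opprK.
Qed.

End Boundary.

Theorem theorem17 (R : realType) (n p q : nat) (n_ge1 : (1 <= n)%N)
    (pq_le : (p + q <= n)%N)
    (vol : 'cV[Cplx R]_n.+1 -> probability (borel_vec R n) R)
    (volM : is_volM vol)
    (al : forms R n (p + q)) (al_sec : section_Hpq al)
    (u : 'cV[Cplx R]_n.+1) (u_sphere : Bsphere u)
    (al_u : forall Xi, inH u Xi -> al u Xi = 0)
    (a : R) (a_gt0 : 0 < a) (gam : R -> 'cV[Cplx R]_n.+1)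
    (gam_cont : {within `[0, a[%classic, continuous gam})
    (gam0 : gam 0 = u) (gam_ball : forall t, 0 < t < a -> Bball (gam t)) :
  (forall e : R, 0 < e -> \forall t \near (0 : R)^'+,
     forall Xi : 'M[Cplx R]_(n.+1, p + q),
       (forall j, bergman (gam t) (col j Xi) (col j Xi) <= 1) ->
       `|Poisson vol al (gam t) Xi| <= toC e) /\
  (forall e : R, 0 < e -> \forall t \near (0 : R)^'+,
     forall Xi : 'M[Cplx R]_(n.+1, p + q), inH (gam t) Xi ->
       (forall j, herm (col j Xi) (col j Xi) <= 1) ->
       `|Poisson vol al (gam t) Xi| <= toC e).
Proof.
have [al_smooth al_pt] := al_sec.
have [B B0 alB] := coeff_size_bounded al_smooth.
have main (e : R) : 0 < e -> \forall t \near (0 : R)^'+, Bball (gam t) /\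
    forall Xi : 'M[Cplx R]_(n.+1, p + q),
      (forall j, bergman (gam t) (col j Xi) (col j Xi) <= (1 - herm (gam t) (gam t))^-1) ->
      `|Poisson vol al (gam t) Xi| <= toC e.
  move=> e0.
  pose T j := (2 * (128 * (n.+1 * 2 ^ j) ^ 2))%N.
  pose G : R := ((2 * T 1) ^ (p + q))%N%:R.
  have G0 : 0 < G by rewrite ltr0n expn_gt0 !muln_gt0.
  (* The bound reads 6 G eps + 4 G B 2^(-J); eps and J make each term at most e / 2. The radius d is
     chosen last, after J has fixed the aperture to be handled. *)
  pose eps : R := e / (12%:R * G).
  have eps0 : 0 < eps by rewrite divr_gt0 // mulr_gt0.
  have [J JP] : exists J : nat, 8%:R * G * B / e <= 2%:R ^+ J :> R.
    exists (Num.truncn (8%:R * G * B / e)).+1.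
    apply: le_trans (ltW (truncnS_gt _)) _.
    by rewrite -natrX ler_nat ltnW // ltn_expl.
  have [d d0 dP] := coeff_size_small al_smooth u_sphere al_u eps0.
  have near_u := narrow_near (T J) u_sphere d0.
  have gu := cvg_right_of_within a_gt0 gam_cont; rewrite gam0 in gu.
  near=> t.
  have tB : Bball (gam t).
    by apply: gam_ball; apply/andP; split; [near: t; exact: nbhs_right_gt|
      near: t; exact: nbhs_right_lt].
  split => // Xi XiB.
  have tnear : Bball (gam t) -> forall v, Bsphere v ->
      aperture (gam t) v <= (T J)%:R -> herm (v - u) (v - u) < toC d.
    by near: t; exact: gu near_u.
  apply: le_trans (Poisson_bound n_ge1 volM pq_le (al := al) (e := eps) (J := J)
    tB (ltW eps0) B0 _ alB _ XiB) _.
  - move=> v r Z vS r0 ZH Zr.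
    exact: (form_coeff_bound vS (al_pt v vS).1 r0 ZH Zr).
  - by move=> v vS ap; apply: dP => //; exact: tnear.
  rewrite ler_toC -/(T 1) -/G exprVn.
  have GB : G * B * (2%:R ^+ J)^-1 <= e / 8%:R.
    rewrite ler_pdivrMr ?exprn_gt0 // mulrC -ler_pdivrMl; last by rewrite divr_gt0.
    by apply: le_trans JP; rewrite le_eqVlt; apply/orP; left; apply/eqP; field; rewrite gt_eqF.
  have Ge : G * eps = e / 12%:R by rewrite /eps; field; rewrite gt_eqF.
  rewrite (_ : _ * _ = 6%:R * (G * eps) + 4%:R * (G * B * (2%:R ^+ J)^-1)); last by ring.
  by rewrite Ge; lra.
split => e e0; apply: filterS (main e e0) => t [tB tP] Xi.
(* Inside the ball 1 <= 1 / (1 - |z|^2). *)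
- move=> XiB; apply: tP => j; apply: le_trans (XiB j) _.
  have z1 : 0 < 1 - herm (gam t) (gam t) by rewrite subr_gt0.
  by rewrite invf_ge1 // gerBl herm_ge0.
- move=> XiH XiB; apply: tP => j.
  have z1 : 0 < 1 - herm (gam t) (gam t) by rewrite subr_gt0.
  have xz : herm (col j Xi) (gam t) = 0.
    transitivity (((gam t)^t* *m Xi) 0 j); last by rewrite XiH mxE.
    by rewrite /herm !mxE; apply: eq_bigr => i _; rewrite !mxE.
  (* For x orthogonal to z the second term of the metric vanishes, leaving |x|^2 / (1 - |z|^2). *)
  by rewrite /bergman xz !mul0r addr0 -[leRHS]mul1r ler_pM2r ?invr_gt0.
Unshelve. all: by end_near. Qed.
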